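(* Let $\mathscr{H}$ be a Hilbert $C^*$-module and let $Q\in\mathcal{L}(\mathscr{H})$ be an idempotent. Then the matched pair $(m(Q),Q)$ is harmonious if and only if it is semi-harmonious.
   Context: $\mathfrak{A}$ is a $C^*$-algebra and $\mathscr{H}$ is a (right) Hilbert $\mathfrak{A}$-module; $\mathcal{L}(\mathscr{H})$ is the $C^*$-algebra of adjointable operators on $\mathscr{H}$, and $I$ is the identity operator on $\mathscr{H}$. For $T\in\mathcal{L}(\mathscr{H})$, $\mathcal{R}(T)$ and $T^*$ denote its range and adjoint, $|T|=(T^*T)^{1/2}$ and $|T^*|=(TT^* )^{1/2}$; the bar denotes norm closure. An idempotent is $Q\in\mathcal{L}(\mathscr{H})$ with $Q^2=Q$; a projection is a self-adjoint idempotent. A closed submodule $\mathscr{M}$ of $\mathscr{H}$ is orthogonally complemented in $\mathscr{H}$ if $\mathscr{H}=\mathscr{M}+\mathscr{M}^\perp$; then $P_{\mathscr{M}}$ denotes the projection from $\mathscr{H}$ onto $\mathscr{M}$. $T\in\mathcal{L}(\mathscr{H})$ has the polar decomposition if there is a partial isometry $U\in\mathcal{L}(\mathscr{H})$ with $T=U|T|$ and $U^*U=P_{\overline{\mathcal{R}(T^* )}}$ (in particular $\overline{\mathcal{R}(T^* )}$ is orthogonally complemented). A quasi-projection pair $(P,Q)$ on $\mathscr{H}$ consists of a projection $P\in\mathcal{L}(\mathscr{H})$ and an idempotent $Q\in\mathcal{L}(\mathscr{H})$ such that $PQ^*P=PQP$, $PQ^*(I-P)=-PQ(I-P)$ and $(I-P)Q^*(I-P)=(I-P)Q(I-P)$;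 equivalently, $Q^*=(2P-I)Q(2P-I)$. It is semi-harmonious if both $P(I-Q)$ and $(I-P)Q$ have the polar decomposition. It is harmonious if both $\overline{\mathcal{R}(PQ(I-P))}$ and $\overline{\mathcal{R}((I-P)QP)}$ are orthogonally complemented in $\mathscr{H}$. For an idempotent $Q\in\mathcal{L}(\mathscr{H})$, its matched projection is $$m(Q)=\tfrac12\big(|Q^*|+Q^*\big)|Q^*|^\dagger\big(|Q^*|+I\big)^{-1}\big(|Q^*|+Q\big),$$ where $|Q^*|^\dagger$ is the Moore–Penrose inverse of $|Q^*|$, which exists and equals $\big(P_{\mathcal{R}(Q)}P_{\mathcal{R}(Q^* )}P_{\mathcal{R}(Q)}\big)^{1/2}$. It is known that $m(Q)$ is a projection and $(m(Q),Q)$ is a quasi-projection pair, called the matched pair of $Q$. *)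

(* Defs.v *)
(* Hilbert C*-modules, adjointable operators and quasi-projection pairs, on top
   of MathComp-Analysis.  The structures are parametrized by a field of scalars
   K : numClosedFieldType, in which norms take their values; complex C*-algebras
   and their Hilbert modules are the case K = R[i] with R : realType.  Products
   of operators are compositions: (S * T) x = S (T x). *)
From HB Require Import structures.
From mathcomp Require Import all_boot all_order all_algebra.
From mathcomp Require Import all_classical all_reals all_analysis.
Import Order.TTheory GRing.Theory Num.Theory.
Import numFieldNormedType.Exports.

Set Implicit Arguments.
Unset Strict Implicit.
Unset Printing Implicit Defensive.

Local Open Scope classical_set_scope.
Local Open Scope ring_scope.

(* The multiplication is not the ring multiplication of MathComp because a
   C*-algebra need not have a unit. *)
HB.mixin Record isCStarAlgebra (K : numClosedFieldType) A
    of CompleteNormedModule K A := {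
  cmul : A -> A -> A;
  cstar : A -> A;
  cmulA : forall a b c, cmul a (cmul b c) = cmul (cmul a b) c;
  cmulDl : forall a b c, cmul (a + b) c = cmul a c + cmul b c;
  cmulDr : forall a b c, cmul a (b + c) = cmul a b + cmul a c;
  cscaleAl : forall (z : K) a b, z *: cmul a b = cmul (z *: a) b;
  cscaleAr : forall (z : K) a b, z *: cmul a b = cmul a (z *: b);
  cstarK : forall a, cstar (cstar a) = a;
  cstarD : forall a b, cstar (a + b) = cstar a + cstar b;
  cstarZ : forall (z : K) a, cstar (z *: a) = z^* *: cstar a;
  cstarM : forall a b, cstar (cmul a b) = cmul (cstar b) (cstar a);
  cnormM : forall a b, `|cmul a b| <= `|a| * `|b|;
  cnorm_star : forall a, `|cmul (cstar a) a| = `|a| ^+ 2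
}.

#[short(type="cstarAlgType")]
HB.structure Definition CStarAlgebra (K : numClosedFieldType) :=
  {A of isCStarAlgebra K A & CompleteNormedModule K A}.

Definition cpositive (K : numClosedFieldType) (A : cstarAlgType K) (a : A) : Prop :=
  exists b : A, a = cmul (cstar b) b.

(* Right Hilbert A-modules; the A-valued inner product is linear in its second
   argument.  The last axiom says that the complete norm carried by the base
   structure is the norm |<x, x>|^(1/2). *)
HB.mixin Record isHilbertModule (K : numClosedFieldType) (A : cstarAlgType K) H
    of CompleteNormedModule K H := {
  hact : H -> A -> H;
  hdot : H -> H -> A;
  hactDl : forall x y a, hact (x + y) a = hact x a + hact y a;
  hactDr : forall x a b, hact x (a + b) = hact x a + hact x b;
  hactA : forall x a b, hact x (cmul a b) = hact (hact x a) b;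
  hactZl : forall (z : K) x a, hact (z *: x) a = z *: hact x a;
  hactZr : forall (z : K) x a, hact x (z *: a) = z *: hact x a;
  hdotDr : forall x y z, hdot x (y + z) = hdot x y + hdot x z;
  hdotZr : forall (z : K) x y, hdot x (z *: y) = z *: hdot x y;
  hdot_act : forall x y a, hdot x (hact y a) = cmul (hdot x y) a;
  hdot_star : forall x y, hdot y x = cstar (hdot x y);
  hdot_ge0 : forall x, cpositive (hdot x x);
  hdot_eq0 : forall x, hdot x x = 0 -> x = 0;
  hnormE : forall x, `|x| ^+ 2 = `|hdot x x|
}.

#[short(type="hilbertModType")]
HB.structure Definition HilbertModule
    (K : numClosedFieldType) (A : cstarAlgType K) :=
  {H of isHilbertModule K A H & CompleteNormedModule K H}.

(* As usual for Hilbert modules, an adjointable operator is any map having an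
   adjoint for the inner product; linearity and boundedness follow. *)
Record adjop (K : numClosedFieldType) (A : cstarAlgType K)
    (H : hilbertModType A) := AdjOp {
  adj_fun :> H -> H;
  adj_adj : H -> H;
  adjopE : forall x y, hdot (adj_fun x) y = hdot x (adj_adj y)
}.

Notation "''L' ( H )" := (adjop H) (at level 8, format "''L' ( H )") : type_scope.

Section HilbertModuleTheory.
Context {K : numClosedFieldType} {A : cstarAlgType K} {H : hilbertModType A}.
Implicit Types (x y : H) (S T : 'L(H)).

Lemma hdot0r x : hdot x 0 = 0.
Proof. by have := hdotZr 0 x (0 : H); rewrite !scale0r. Qed.

Lemma hdotNr x y : hdot x (- y) = - hdot x y.
Proof. by rewrite -scaleN1r hdotZr scaleN1r. Qed.

Lemma cstar0 : cstar (0 : A) = 0.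
Proof. by have := cstarZ 0 (0 : A); rewrite rmorph0 !scale0r. Qed.

Lemma hdot0l y : hdot 0 y = 0.
Proof. by rewrite hdot_star hdot0r cstar0. Qed.

Lemma hdotDl x y z : hdot (x + y) z = hdot x z + hdot y z.
Proof. by rewrite hdot_star hdotDr cstarD -!hdot_star. Qed.

Lemma hdotZl (c : K) x y : hdot (c *: x) y = c^* *: hdot x y.
Proof. by rewrite hdot_star hdotZr cstarZ -hdot_star. Qed.

Lemma hdotNl x y : hdot (- x) y = - hdot x y.
Proof. by rewrite -scaleN1r hdotZl rmorphN rmorph1 scaleN1r. Qed.

Lemma hdot_injr y z : (forall x, hdot x y = hdot x z) -> y = z.
Proof.
move=> e; apply/eqP; rewrite -subr_eq0; apply/eqP/hdot_eq0.
by rewrite hdotDr hdotNr e subrr.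
Qed.

Lemma adjopP S T : S =1 T -> S = T.
Proof.
case: S T => [s s' es] [t t' et] /= est.
have {}est : s = t by apply: funext.
have est' : s' = t'.
  by apply: funext => y; apply: hdot_injr => x; rewrite -es -et est.
by subst; congr AdjOp; exact: Prop_irrelevance.
Qed.

Fact adj_subproof T x y : hdot (adj_adj T x) y = hdot x (T y).
Proof. by rewrite hdot_star -adjopE -hdot_star. Qed.
Definition adj T : 'L(H) := AdjOp (adj_subproof T).

Fact adjop0_subproof x y : hdot (0 : H) y = hdot x 0.
Proof. by rewrite hdot0l hdot0r. Qed.
Definition adjop0 : 'L(H) := AdjOp adjop0_subproof.

Definition adjop1 : 'L(H) := @AdjOp K A H id id (fun x y => erefl).

Fact adjop_opp_subproof T x y : hdot (- T x) y = hdot x (- adj_adj T y).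
Proof. by rewrite hdotNl hdotNr adjopE. Qed.
Definition adjop_opp T : 'L(H) := AdjOp (adjop_opp_subproof T).

Fact adjop_add_subproof S T x y :
  hdot (S x + T x) y = hdot x (adj_adj S y + adj_adj T y).
Proof. by rewrite hdotDl hdotDr !adjopE. Qed.
Definition adjop_add S T : 'L(H) := AdjOp (adjop_add_subproof S T).

Fact adjop_mul_subproof S T x y :
  hdot (S (T x)) y = hdot x (adj_adj T (adj_adj S y)).
Proof. by rewrite !adjopE. Qed.
Definition adjop_mul S T : 'L(H) := AdjOp (adjop_mul_subproof S T).

Fact adjop_scale_subproof (c : K) T x y :
  hdot (c *: T x) y = hdot x (c^* *: adj_adj T y).
Proof. by rewrite hdotZl hdotZr adjopE. Qed.
Definition adjop_scale c T : 'L(H) := AdjOp (adjop_scale_subproof c T).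

Lemma adjop_linearD T x y : T (x + y) = T x + T y.
Proof.
apply: hdot_injr => z; rewrite hdotDr.
by rewrite -!(adj_subproof T) hdotDr.
Qed.

Lemma adjop_linearZ T (c : K) x : T (c *: x) = c *: T x.
Proof.
apply: hdot_injr => z; rewrite hdotZr.
by rewrite -!(adj_subproof T) hdotZr.
Qed.

Lemma adjop_linear0 T : T 0 = 0.
Proof. by have := adjop_linearZ T 0 0; rewrite !scale0r. Qed.

End HilbertModuleTheory.

Section Instances.
Context (K : numClosedFieldType) (A : cstarAlgType K) (H : hilbertModType A).

HB.instance Definition _ := gen_eqMixin 'L(H).
HB.instance Definition _ := gen_choiceMixin 'L(H).

Fact adjop_addA : associative (@adjop_add K A H).
Proof. by move=> S T U; apply: adjopP => x /=; rewrite addrA. Qed.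
Fact adjop_addC : commutative (@adjop_add K A H).
Proof. by move=> S T; apply: adjopP => x /=; rewrite addrC. Qed.
Fact adjop_add0 : left_id (@adjop0 K A H) adjop_add.
Proof. by move=> T; apply: adjopP => x /=; rewrite add0r. Qed.
Fact adjop_addN : left_inverse (@adjop0 K A H) adjop_opp adjop_add.
Proof. by move=> T; apply: adjopP => x /=; rewrite addNr. Qed.

HB.instance Definition _ :=
  GRing.isZmodule.Build 'L(H) adjop_addA adjop_addC adjop_add0 adjop_addN.

Fact adjop_mulA : associative (@adjop_mul K A H).
Proof. by move=> S T U; apply: adjopP. Qed.
Fact adjop_mul1 : left_id (@adjop1 K A H) adjop_mul.
Proof. by move=> T; apply: adjopP. Qed.
Fact adjop_1mul : right_id (@adjop1 K A H) adjop_mul.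
Proof. by move=> T; apply: adjopP. Qed.
Fact adjop_mulDl : left_distributive (@adjop_mul K A H) +%R.
Proof. by move=> S T U; apply: adjopP. Qed.
Fact adjop_mulDr : right_distributive (@adjop_mul K A H) +%R.
Proof. by move=> S T U; apply: adjopP => x /=; rewrite adjop_linearD. Qed.

HB.instance Definition _ := GRing.Zmodule_isPzRing.Build 'L(H)
  adjop_mulA adjop_mul1 adjop_1mul adjop_mulDl adjop_mulDr.

Fact adjop_scaleA (a b : K) (T : 'L(H)) :
  adjop_scale a (adjop_scale b T) = adjop_scale (a * b) T.
Proof. by apply: adjopP => x /=; rewrite scalerA. Qed.
Fact adjop_scale1 : left_id 1 (@adjop_scale K A H).
Proof. by move=> T; apply: adjopP => x /=; rewrite scale1r. Qed.
Fact adjop_scaleDr : right_distributive (@adjop_scale K A H) +%R.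
Proof. by move=> c S T; apply: adjopP => x /=; rewrite scalerDr. Qed.
Fact adjop_scaleDl (T : 'L(H)) :
  {morph (fun c : K => adjop_scale c T) : a b / a + b}.
Proof. by move=> a b; apply: adjopP => x /=; rewrite scalerDl. Qed.

HB.instance Definition _ := GRing.Zmodule_isLmodule.Build K 'L(H)
  adjop_scaleA adjop_scale1 adjop_scaleDr adjop_scaleDl.

End Instances.

Section QuasiProjectionPairs.
Context {K : numClosedFieldType} {A : cstarAlgType K} {H : hilbertModType A}.
Implicit Types (P Q S T U X : 'L(H)) (M : set H).

Definition is_idempotent Q : Prop := Q * Q = Q.
Definition is_projection P : Prop := is_idempotent P /\ adj P = P.
Definition partial_isometry U : Prop := is_projection (adj U * U).

Definition op_positive S : Prop := exists X, S = adj X * X.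

(* |T|, |T|^dagger and T^-1 are the unique operators with the stated properties;
   xget returns that operator (and 0 when there is none). *)
Definition op_abs T : 'L(H) :=
  xget 0 [set S | op_positive S /\ S * S = adj T * T].

Definition moore_penrose T : 'L(H) :=
  xget 0 [set X | [/\ T * X * T = T, X * T * X = X,
                      adj (T * X) = T * X & adj (X * T) = X * T]].

Definition op_inv T : 'L(H) := xget 0 [set X | X * T = 1 /\ T * X = 1].

Definition orth_compl M : set H := [set y | forall x, M x -> hdot x y = 0].

(* Only used for closed submodules M. *)
Definition orth_complemented M : Prop :=
  forall z, exists x y, [/\ M x, orth_compl M y & z = x + y].

Definition is_projection_onto M P : Prop := is_projection P /\ range P = M.

Definition has_polar_decomposition T : Prop :=
  let M := closure (range (adj T)) in
  orth_complemented M /\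
  exists U, [/\ partial_isometry U, T = U * op_abs T
              & is_projection_onto M (adj U * U)].

Definition quasi_projection_pair P Q : Prop :=
  [/\ is_projection P, is_idempotent Q
    & [/\ P * adj Q * P = P * Q * P,
          P * adj Q * (1 - P) = - (P * Q * (1 - P))
        & (1 - P) * adj Q * (1 - P) = (1 - P) * Q * (1 - P)]].

Definition semi_harmonious P Q : Prop :=
  [/\ quasi_projection_pair P Q,
      has_polar_decomposition (P * (1 - Q))
    & has_polar_decomposition ((1 - P) * Q)].

Definition harmonious P Q : Prop :=
  [/\ quasi_projection_pair P Q,
      orth_complemented (closure (range (P * Q * (1 - P))))
    & orth_complemented (closure (range ((1 - P) * Q * P)))].

Definition matched_projection Q : 'L(H) :=
  let B := op_abs (adj Q) in
  2^-1 *: ((B + adj Q) * moore_penrose B * op_inv (B + 1) * (B + Q)).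

End QuasiProjectionPairs.

(* Main.v *)
Require Import Defs.
From mathcomp Require Import all_boot all_order all_algebra.
From mathcomp Require Import complex.
From mathcomp Require Import all_classical all_reals all_analysis.
From mathcomp Require Import ring lra.
From Stdlib Require Ncring Ncring_tac.
Set Implicit Arguments. Unset Strict Implicit. Unset Printing Implicit Defensive.
Import Order.TTheory GRing.Theory Num.Theory.
Import numFieldNormedType.Exports.
Local Open Scope classical_set_scope.
Local Open Scope ring_scope.

(** Put [P = m(Q)] and let [A = P Q P], [D = (1 - P) Q (1 - P)] be the diagonal
    corners of [Q].  For a quasi-projection pair the off-diagonal corners are
    [B = P Q (1 - P)] and [- B^*], and [Q^2 = Q] says [B B^* = A^2 - A] and
    [B^* B = D^2 - D].  What singles out the matched projection is a sign:
    there [2 A - P >= 0] and [D <= 0] ([matched_corners]).  So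
    [E = 2 A - 2 P + 1] and [1 - 2 D] are positive, with
    [E^2 = 1 + 4 B B^*] in the first case, and [E] and [E + 1] are invertible.

    The two operators [T = P (1 - Q)] and [(1 - P) Q] have the same shape: up to
    a factor [-2], [T] is [E - 1 + C] with [C = 2 B], [C C^* = E^2 - 1] and
    [C (E - 1) = 0].  Both [T T^*] and [C C^*] are [E - 1] times an invertible
    operator commuting with it, and the closures of the ranges of [X] and
    [X X^*] agree ([closure_range_mul_adj]); hence [T] and [B] have the same
    closed range ([corner_closure_range]).  An operator has a polar
    decomposition exactly when the closed ranges of it and of its adjoint are
    complemented ([polar_complemented], [polar_of_complemented]), so one
    implication is immediate.  For the other one, the closed range of [T^*]
    has to be complemented as well; the polar decomposition [C = U |C|] exhibits
    the projection onto it ([corner_adj_complemented]).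

    All this rests on the order structure of the algebra of adjointable
    operators, developed here by elementary means that avoid the order
    structure of the coefficient algebra.  Polarization gives a Cauchy--Schwarz
    inequality with constant [4], hence continuity of the inner product and, by
    a Baire argument, boundedness of adjointable operators.  Sharp norm
    estimates come from unitaries, which are isometric for trivial reasons: if
    the powers of a self-adjoint [a] are bounded then [1 - a^2] has a square
    root [s], the operators [a + i s] and [a - i s] are unitary, and their mean
    [a] is a contraction ([power_bounded_circle]).  With positivity defined by
    [|t - T| <= t] for some [t > 0], this yields square roots and the
    positivity of every [c^* c] ([adj_mul_pos]), so that [1 + c^* c] is
    invertible and absolute values exist. *)

(** * Real-valued norms *)

Section Norm.
Variables (R : realType) (V : normedModType R[i]).
Implicit Types (x y : V).

(** Norms take their values in the complex field; [nrm] reads them in the reals,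
    where linear arithmetic applies. *)
Definition nrm x : R := complex.Re `|x|.

Lemma nrmE x : `|x| = (nrm x)%:C%C.
Proof.
have := normr_ge0 x; rewrite /nrm; case: (`|x|) => a b.
by rewrite lecE /= => /andP[/eqP -> _].
Qed.

Lemma nrm_ge0 x : 0 <= nrm x.
Proof. by have := normr_ge0 x; rewrite nrmE lecR. Qed.

Lemma nrm0 : nrm 0 = 0.
Proof. by rewrite /nrm normr0. Qed.

Lemma nrm_eq0 x : nrm x = 0 -> x = 0.
Proof. by move=> e; apply/eqP; rewrite -normr_eq0 nrmE e. Qed.

Lemma nrmD x y : nrm (x + y) <= nrm x + nrm y.
Proof. by have := ler_normD x y; rewrite !nrmE -rmorphD lecR. Qed.

Lemma nrmN x : nrm (- x) = nrm x.
Proof. by rewrite /nrm normrN. Qed.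

Lemma nrmB x y : nrm (x - y) <= nrm x + nrm y.
Proof. by rewrite -(nrmN y) nrmD. Qed.

Lemma nrm_dist x y : nrm (x - y) = nrm (y - x).
Proof. by rewrite -nrmN opprB. Qed.

Lemma nrmZ (z : R[i]) x : nrm (z *: x) = complex.Re `|z| * nrm x.
Proof.
rewrite /nrm normrZ nrmE.
have := normr_ge0 z; case: (`|z|) => a b.
by rewrite lecE /= => /andP[/eqP -> _]; rewrite mulr0 subr0.
Qed.

Lemma nrmZr (r : R) x : nrm (r%:C%C *: x) = `|r| * nrm x.
Proof. by rewrite nrmZ normc_def /= expr0n /= addr0 sqrtr_sqr. Qed.

Definition tends (u : nat -> V) (l : V) :=
  forall e : R, 0 < e -> exists N, forall n, (N <= n)%N -> nrm (u n - l) < e.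

Lemma tends_uniq u l l' : tends u l -> tends u l' -> l = l'.
Proof.
move=> ul ul'; apply/eqP; rewrite -subr_eq0; apply/eqP/nrm_eq0/eqP.
rewrite eq_le nrm_ge0 andbT; apply/ler_addgt0Pl => e e0; rewrite addr0.
have e2 : 0 < e / 2 by lra.
have [N hN] := ul _ e2; have [N' hN'] := ul' _ e2.
have := hN _ (leq_maxl N N'); have := hN' _ (leq_maxr N N').
have := nrmB (u (maxn N N') - l') (u (maxn N N') - l).
rewrite opprB [in nrm (_ + _)]addrC addrA subrK => ? ? ?; lra.
Qed.

Lemma closureP (M : set V) x :
  closure M x <-> forall e : R, 0 < e -> exists2 y, M y & nrm (x - y) < e.
Proof.
split=> [cx e e0|h B /nbhs_ballP[e /= e0 he]].
  have [|y [My]] := cx (ball x e%:C%C); first by apply: nbhsx_ballx; rewrite ltcR.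
  by rewrite -ball_normE /= nrmE ltcR => ?; exists y.
move: e0; rewrite /= => e0.
have eE : e = (complex.Re e)%:C%C.
  by case: e e0 {he} => a b; rewrite ltcE /= => /andP[/eqP -> _].
rewrite eE in e0 he; rewrite ltcR in e0.
have [y My xy] := h _ e0; exists y; split => //; apply: he.
by rewrite -ball_normE /= nrmE ltcR.
Qed.

End Norm.

Lemma cauchy_tends (R : realType) (V : completeNormedModType R[i]) (u : nat -> V) :
  (forall e : R, 0 < e -> exists N, forall m n, (N <= m)%N -> (N <= n)%N ->
     nrm (u m - u n) < e) ->
  exists l, tends u l.
Proof.
move=> h.
have /cauchy_cvg/cvg_ex[l ul] : cauchy (u @ \oo).
  apply/cauchy_exP => e /= e0.
  have eE : e = (complex.Re e)%:C%C.
    by case: e e0 => a b; rewrite ltcE /= => /andP[/eqP -> _].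
  rewrite eE in e0 *; rewrite ltcR in e0.
  have [N hN] := h _ e0; exists (u N); exists N => // n /= Nn.
  by rewrite -ball_normE /= nrmE ltcR; exact: hN.
exists l => e e0.
have := ul (ball l e%:C%C) (nbhsx_ballx _ _ _).
rewrite ltcR => /(_ e0) [N _ hN]; exists N => n Nn.
by have := hN n Nn; rewrite /= -ball_normE /= nrmE ltcR nrm_dist.
Qed.

Lemma half_pow_small (R : realType) (e : R) : 0 < e -> exists N, 2^-1 ^+ N < e.
Proof.
move=> e0; exists (Num.Def.archi_bound e^-1); set N := Num.Def.archi_bound _.
rewrite exprVn invf_plt ?posrE ?exprn_gt0//.
apply: (@lt_trans _ _ N%:R); first by rewrite archi_boundP// invr_ge0 ltW.
by rewrite -natrX ltr_nat ltn_expl.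
Qed.

Local Notation "c ** T" := (c%:C%C *: T) (at level 40, T at level 30) : ring_scope.

(** * The algebra of adjointable operators *)

Section OperatorRing.
Variables (R : realType) (A : cstarAlgType R[i]) (H : hilbertModType A).
Implicit Types (x y z : H) (S T U V X Z P Q : 'L(H)).

(* Makes the decision procedure for noncommutative ring identities available. *)
#[local] Instance adjop_ops :
  @Ncring.Ring_ops 'L(H) 0 1 +%R *%R (fun S T => S - T) -%R (@eq 'L(H)) := {}.

#[local] Instance adjop_ring : Ncring.Ring (Ro := adjop_ops).
Proof.
constructor; rewrite /Algebra_syntax.equality /Ncring.eq_notation /=; try exact: _.
- exact: add0r.
- exact: addrC.
- exact: addrA.
- exact: mul1r.
- exact: mulr1.
- exact: mulrA.
- exact: mulrDl.
- by move=> x y z; exact: mulrDr.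
- exact: subrr.
Qed.

End OperatorRing.

#[local] Existing Instance adjop_ops.
#[local] Existing Instance adjop_ring.

Ltac ncring :=
  lazymatch goal with |- @eq _ ?x ?y => change (@eq (adjop _) x y) end;
  Ncring_tac.non_commutative_ring.

Section Operators.
Variables (R : realType) (A : cstarAlgType R[i]) (H : hilbertModType A).
Implicit Types (x y z : H) (S T U V X Z P Q : 'L(H)).

Lemma opM S T x : (S * T) x = S (T x). Proof. by []. Qed.
Lemma opD S T x : (S + T) x = S x + T x. Proof. by []. Qed.
Lemma opN S x : (- S) x = - S x. Proof. by []. Qed.
Lemma opB S T x : (S - T) x = S x - T x. Proof. by []. Qed.
Lemma opZ (c : R[i]) S x : (c *: S) x = c *: S x. Proof. by []. Qed.
Lemma op1 x : (1 : 'L(H)) x = x. Proof. by []. Qed.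
Lemma op0 x : (0 : 'L(H)) x = 0. Proof. by []. Qed.
Definition opE := (opM, opD, opN, opB, opZ, op1, op0).

Lemma op_vecD S x y : S (x + y) = S x + S y. Proof. exact: adjop_linearD. Qed.
Lemma op_vecZ S (c : R[i]) x : S (c *: x) = c *: S x. Proof. exact: adjop_linearZ. Qed.
Lemma op_vec0 S : S 0 = 0. Proof. exact: adjop_linear0. Qed.
Lemma op_vecN S x : S (- x) = - S x.
Proof. by rewrite -scaleN1r op_vecZ scaleN1r. Qed.
Lemma op_vecB S x y : S (x - y) = S x - S y.
Proof. by rewrite op_vecD op_vecN. Qed.

Lemma op_mulZl (c : R[i]) S T : (c *: S) * T = c *: (S * T).
Proof. by apply: adjopP => x. Qed.
Lemma op_mulZr (c : R[i]) S T : S * (c *: T) = c *: (S * T).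
Proof. by apply: adjopP => x; rewrite !opE op_vecZ. Qed.

Lemma adjP S x y : hdot (S x) y = hdot x (adj S y).
Proof. exact: adjopE. Qed.

Lemma adjK S : adj (adj S) = S.
Proof. by apply: adjopP. Qed.
Lemma adjM S T : adj (S * T) = adj T * adj S.
Proof. by apply: adjopP. Qed.
Lemma adjD S T : adj (S + T) = adj S + adj T.
Proof. by apply: adjopP. Qed.
Lemma adjN S : adj (- S) = - adj S.
Proof. by apply: adjopP. Qed.
Lemma adjB S T : adj (S - T) = adj S - adj T.
Proof. by apply: adjopP. Qed.
Lemma adjZ (c : R[i]) S : adj (c *: S) = c^* *: adj S.
Proof. by apply: adjopP. Qed.
Lemma adj1 : adj (1 : 'L(H)) = 1.
Proof. by apply: adjopP. Qed.
Lemma adj0 : adj (0 : 'L(H)) = 0.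
Proof. by apply: adjopP. Qed.
Lemma adjZr (c : R) S : adj (c ** S) = c ** adj S.
Proof. by rewrite adjZ; congr (_ *: _); exact: conjc_real. Qed.

Lemma adjX S n : adj (S ^+ n) = adj S ^+ n.
Proof. by elim: n => [|n IH]; rewrite ?expr0 ?adj1// exprS adjM IH exprSr. Qed.

Lemma nrm_hdot x : nrm x ^+ 2 = nrm (hdot x x).
Proof.
have := @hnormE _ _ H x; rewrite !nrmE -rmorphXn /=.
by move=> /(congr1 (@complex.Re R)).
Qed.

Lemma hdotBr x y z : hdot x (y - z) = hdot x y - hdot x z.
Proof. by rewrite hdotDr hdotNr. Qed.

Lemma hdotBl x y z : hdot (x - y) z = hdot x z - hdot y z.
Proof. by rewrite hdotDl hdotNl. Qed.

(** * A Cauchy--Schwarz inequality *)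

Lemma polarization_real x y :
  hdot (x + y) (x + y) - hdot (x - y) (x - y) = (hdot x y + hdot y x) *+ 2.
Proof.
set a := hdot x x; set b := hdot x y; set c := hdot y x; set d := hdot y y.
have -> : hdot (x + y) (x + y) = (a + d) + (b + c).
  by rewrite hdotDr !hdotDl [_ + hdot y y]addrC addrACA [_ + hdot x y]addrC.
have -> : hdot (x - y) (x - y) = (a + d) - (b + c).
  by rewrite hdotDr hdotNr !hdotBl opprB addrACA -opprD [c + _]addrC.
by rewrite opprB [LHS]addrC subrKA mulr2n.
Qed.

Lemma polarization x y :
  hdot x y *+ 4 = hdot (x + y) (x + y) - hdot (x - y) (x - y)
    - 'i%C *: (hdot (x + 'i%C *: y) (x + 'i%C *: y)
               - hdot (x - 'i%C *: y) (x - 'i%C *: y)).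
Proof.
have conji : ('i%C : R[i])^* = - 'i%C :> R[i].
  by apply/eqP; rewrite eq_complex /= oppr0 !eqxx.
have ii : 'i%C * 'i%C = -1 :> R[i] by rewrite -expr2 sqr_i.
rewrite !polarization_real hdotZr hdotZl conji -scalerMnr scalerDr.
rewrite !scalerA mulrN ii opprK scaleN1r scale1r.
by rewrite -mulrnBl opprD opprK addrACA subrr addr0 -mulr2n -mulrnA.
Qed.

Lemma nrm_hdot_le x y : nrm (hdot x y) <= (nrm x + nrm y) ^+ 2.
Proof.
have nrmi : nrm ('i%C *: y) = nrm y.
  by rewrite nrmZ normc_def /= expr0n expr1n /= add0r sqrtr1 mul1r.
have sq u v : nrm v = nrm y -> u = v \/ u = - v ->
    nrm (hdot (x + u) (x + u)) <= (nrm x + nrm y) ^+ 2.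
  move=> vy uv; rewrite -nrm_hdot ler_sqr ?nnegrE ?addr_ge0 ?nrm_ge0//.
  by apply: le_trans (nrmD _ _) _; case: uv => ->; rewrite ?nrmN vy.
have : nrm (hdot x y *+ 4) <= 4 * (nrm x + nrm y) ^+ 2.
  rewrite polarization.
  apply: le_trans (nrmB _ _) _; rewrite nrmZ normc_def /= expr0n expr1n /= add0r sqrtr1 mul1r.
  have := nrmB (hdot (x + y) (x + y)) (hdot (x - y) (x - y)).
  have := nrmB (hdot (x + 'i%C *: y) (x + 'i%C *: y)) (hdot (x - 'i%C *: y) (x - 'i%C *: y)).
  have := sq _ _ erefl (or_introl erefl).
  have := sq _ _ erefl (or_intror erefl).
  have := sq _ _ nrmi (or_introl erefl).
  have := sq _ _ nrmi (or_intror erefl).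
  lra.
rewrite -scaler_nat nrmZ normr_nat.
by have -> : complex.Re (4%:R : R[i]) = 4 :> R; [rewrite !raddfMn | rewrite ler_pM2l].
Qed.

(** Polarization bounds [<x, y>] by the four squared norms [|x + i^k y|^2], each at
    most [(|x| + |y|)^2]; rescaling to unit vectors gives the constant [4]. *)
Lemma weak_cauchy_schwarz x y : nrm (hdot x y) <= 4 * nrm x * nrm y.
Proof.
have [->|x0] := eqVneq x 0; first by rewrite hdot0l !nrm0 mulr0 mul0r.
have [->|y0] := eqVneq y 0; first by rewrite hdot0r !nrm0 mulr0.
have pos (u : H) : u != 0 -> 0 < nrm u.
  by move=> u0; rewrite lt_def nrm_ge0 andbT; apply: contraNN u0 => /eqP/nrm_eq0 ->.
have {}x0 := pos _ x0; have {}y0 := pos _ y0.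
have := nrm_hdot_le ((nrm x)^-1 ** x) ((nrm y)^-1 ** y).
have conjr (r : R) : (r%:C%C)^* = r%:C%C :> R[i] by exact: conjc_real.
rewrite !nrmZr !ger0_norm ?invr_ge0 ?nrm_ge0// !mulVf ?gt_eqF//.
rewrite hdotZl hdotZr conjr !nrmZr !ger0_norm ?invr_ge0 ?nrm_ge0//.
rewrite mulrA -invfM mulrC ler_pdivrMr ?mulr_gt0// => h; lra.
Qed.

(** * Boundedness of adjointable operators *)

(** A bound rather than an operator norm: no supremum has to be taken. *)
Definition bnd (c : R) T := 0 <= c /\ forall x, nrm (T x) <= c * nrm x.

(** For a fixed vector [y], the functional [x |-> <y, T x> = <T* y, x>] is
    continuous, so a large value of [T] at one point is inherited by a whole
    neighbourhood. *)
Lemma large_near T x : 0 < nrm (T x) ->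
  exists2 d : R, 0 < d & forall w, nrm (w - x) <= d -> nrm (T x) <= 8 * nrm (T w).
Proof.
move=> Tx0; set y := T x.
exists (nrm y ^+ 2 / (8 * (nrm (adj T y) + 1))).
  by rewrite divr_gt0 ?exprn_gt0// mulr_gt0// ltr_wpDl ?nrm_ge0.
move=> w; have T1 : 0 < nrm (adj T y) + 1 by rewrite ltr_wpDl ?nrm_ge0.
rewrite ler_pdivlMr ?mulr_gt0// => wx.
have e : hdot y y = hdot y (T w) - hdot (adj T y) (w - x).
  by rewrite adjP adjK op_vecB hdotBr opprB addrC subrK.
have := nrmB (hdot y (T w)) (hdot (adj T y) (w - x)).
rewrite -e -nrm_hdot.
have := weak_cauchy_schwarz y (T w); have := weak_cauchy_schwarz (adj T y) (w - x).
have := nrm_ge0 (w - x); have := nrm_ge0 (adj T y); move=> a0 b0 h1 h2 h3.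
rewrite -(ler_pM2l Tx0) -/y.
nra.
Qed.

(** If [T] were bounded by [c] on one ball, differences of its points would make
    it bounded everywhere. *)
Lemma unbounded_on_balls T : ~ (exists c, bnd c T) -> forall x (r c : R),
  0 < r -> 0 <= c -> exists2 w, nrm (w - x) <= r & c < nrm (T w).
Proof.
move=> nb x r c r0 c0; apply: contrapT => h.
have {}h w : nrm w <= r -> nrm (T w) <= 2 * c.
  move=> wr; rewrite leNgt; apply/negP => cw; apply: h.
  have := nrmB (T (w + x)) (T x); rewrite -op_vecB addrK => e.
  have [cx|cx] := ltP c (nrm (T x)).
    by exists x => //; rewrite subrr nrm0 ltW.
  by exists (w + x); [rewrite addrK | lra].
apply: nb; exists (2 * c / r); split; first by rewrite divr_ge0 ?mulr_ge0// ltW.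
move=> w; have [->|w0] := eqVneq w 0; first by rewrite op_vec0 nrm0 mulr0.
have {}w0 : 0 < nrm w.
  by rewrite lt_def nrm_ge0 andbT; apply: contraNN w0 => /eqP/nrm_eq0 ->.
have := h ((r / nrm w) ** w).
rewrite op_vecZ !nrmZr ger0_norm ?divr_ge0 ?(ltW w0) ?(ltW r0)//.
rewrite divfK ?gt_eqF// lexx => /(_ isT).
by rewrite mulrAC ler_pdivrMr// => e; rewrite mulrAC ler_pdivlMr// mulrC.
Qed.

(** Baire-style argument: were [T] unbounded, shrinking balls on which
    [|T w| > n] would close down on a point where [T] takes no finite value. *)
Lemma bounded_op T : exists c, bnd c T.
Proof.
apply: contrapT => nb.
have step (n : nat) (p : H * R) : exists q : H * R, 0 < p.2 ->
    [/\ 0 < q.2, q.2 <= 2^-1 * p.2, nrm (q.1 - p.1) <= 2^-1 * p.2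
      & forall w, nrm (w - q.1) <= q.2 -> n%:R < nrm (T w)].
  case: p => x r /=; have [r0|r0] := ltP 0 r; last by exists (x, r).
  have r2 : 0 < 2^-1 * r by rewrite mulr_gt0 ?invr_gt0.
  have [y yx Ty] := unbounded_on_balls nb x r2 (mulr_ge0 (ler0n R 8) (ler0n R n)).
  have Ty0 : 0 < nrm (T y) by apply: le_lt_trans Ty; rewrite mulr_ge0.
  have [d d0 hd] := large_near Ty0.
  exists (y, Num.min d (2^-1 * r)) => _ /=; split => //.
  - by rewrite lt_min d0.
  - by rewrite ge_min lexx orbT.
  - move=> w; rewrite le_min => /andP[/hd h _].
    by rewrite -(ltr_pM2l (ltr0n R 8)); apply: lt_le_trans Ty h.
pose q := fix q n : H * R := if n is m.+1 then sval (cid (step m (q m))) else (0, 1).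
have q0 n : 0 < (q n).2.
  by elim: n => [|n IH] /=; [exact: ltr01 | case: cid => p /= /(_ IH)[]].
have qS n : [/\ 0 < (q n.+1).2, (q n.+1).2 <= 2^-1 * (q n).2,
    nrm ((q n.+1).1 - (q n).1) <= 2^-1 * (q n).2
    & forall w, nrm (w - (q n.+1).1) <= (q n.+1).2 -> n%:R < nrm (T w)].
  by rewrite /=; case: cid => p /= /(_ (q0 n)).
have near m n : nrm ((q (m + n)%N).1 - (q m).1) <= (q m).2 - (q (m + n)%N).2.
  elim: n => [|n IH]; first by rewrite addn0 !subrr nrm0.
  have [_ h1 h2 _] := qS (m + n)%N.
  have := nrmD ((q (m + n).+1).1 - (q (m + n)%N).1) ((q (m + n)%N).1 - (q m).1).
  rewrite addrA subrK addnS => h3.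
  have := q0 (m + n)%N; lra.
have small n : (q n).2 <= 2^-1 ^+ n.
  elim: n => [|n IH]; first by rewrite expr0.
  have [_ h _ _] := qS n; apply: le_trans h _.
  by rewrite exprS ler_pM2l // invr_gt0.
have near' m n : (m <= n)%N -> nrm ((q n).1 - (q m).1) <= (q m).2.
  move=> /subnKC mn; have := near m (n - m)%N; rewrite mn.
  by have := q0 n; lra.
have [x hx] : exists x, tends (fun n => (q n).1) x.
  apply: cauchy_tends => e e0.
  have e2 : 0 < e / 2 by lra.
  have [N hN] := half_pow_small e2.
  exists N => m n Nm Nn.
  have := nrmB ((q m).1 - (q N).1) ((q n).1 - (q N).1).
  rewrite opprB addrA subrK.
  have := near' _ _ Nm; have := near' _ _ Nn; have := small N; lra.
have xn n : nrm (x - (q n).1) <= (q n).2.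
  apply/ler_addgt0Pr => e e0; have [N hN] := hx _ e0.
  have := hN _ (leq_maxl N n); have := near' _ _ (leq_maxr N n).
  have := nrmB ((q (maxn N n)).1 - (q n).1) ((q (maxn N n)).1 - x).
  rewrite opprB [_ + (x - _)]addrC addrA subrK; lra.
have [_ _ _ /(_ x (xn _))] := qS (Num.Def.archi_bound (nrm (T x))).
by apply/negP; rewrite -leNgt ltW// archi_boundP ?nrm_ge0.
Qed.

End Operators.

(** * Strong limits and the Neumann series *)

Section Limits.
Variables (R : realType) (A : cstarAlgType R[i]) (H : hilbertModType A).
Implicit Types (x y z : H) (S T U V X Z P Q : 'L(H)).

Lemma bndD c d S T : bnd c S -> bnd d T -> bnd (c + d) (S + T).
Proof.
move=> [c0 hS] [d0 hT]; split=> [|x]; first exact: addr_ge0.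
by rewrite mulrDl; apply: le_trans (nrmD _ _) _; exact: lerD.
Qed.

Lemma bndM c d S T : bnd c S -> bnd d T -> bnd (c * d) (S * T).
Proof.
move=> [c0 hS] [d0 hT]; split=> [|x]; first exact: mulr_ge0.
by apply: le_trans (hS _) _; rewrite -mulrA ler_wpM2l.
Qed.

Lemma bndN c S : bnd c S -> bnd c (- S).
Proof. by move=> [c0 h]; split=> // x; rewrite opE nrmN. Qed.

Lemma bndZ (r c : R) S : 0 <= r -> bnd c S -> bnd (r * c) (r ** S).
Proof.
move=> r0 [c0 h]; split=> [|x]; first exact: mulr_ge0.
by rewrite opE nrmZr ger0_norm// -mulrA ler_wpM2l.
Qed.

Lemma bndW c d S : c <= d -> bnd c S -> bnd d S.
Proof.
move=> cd [c0 h]; split=> [|x]; first exact: le_trans cd.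
by apply: le_trans (h x) _; rewrite ler_wpM2r ?nrm_ge0.
Qed.

Lemma bnd1 : bnd 1 (1 : 'L(H)).
Proof. by split=> // x; rewrite mul1r. Qed.

Lemma bnd0 : bnd 0 (0 : 'L(H)).
Proof. by split=> // x; rewrite opE nrm0 mul0r. Qed.

Lemma bndX c S n : bnd c S -> bnd (c ^+ n) (S ^+ n).
Proof.
move=> h; elim: n => [|n IH]; first by rewrite !expr0; exact: bnd1.
by rewrite !exprS; exact: bndM.
Qed.

Lemma bnd_pow1 S n : bnd 1 S -> bnd 1 (S ^+ n).
Proof. by move=> /(bndX n); rewrite expr1n. Qed.

Lemma tendsD (u v : nat -> H) x y :
  tends u x -> tends v y -> tends (fun n => u n + v n) (x + y).
Proof.
move=> ux vy e e0; have e2 : 0 < e / 2 by lra.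
have [N hN] := ux _ e2; have [N' hN'] := vy _ e2.
exists (maxn N N') => n; rewrite geq_max => /andP[/hN h /hN' h'].
by rewrite opprD addrACA; have := nrmD (u n - x) (v n - y); lra.
Qed.

Lemma tends_op S (u : nat -> H) x : tends u x -> tends (fun n => S (u n)) (S x).
Proof.
move=> ux e e0; have [c [c0 h]] := bounded_op S.
have [|N hN] := ux (e / (c + 1)); first by rewrite divr_gt0// ltr_wpDl.
exists N => n /hN; rewrite ltr_pdivlMr ?ltr_wpDl// => hn.
rewrite -op_vecB; apply: le_lt_trans (h _) _.
by have := nrm_ge0 (u n - x); nra.
Qed.

Lemma tends_ext (u v : nat -> H) x : (forall n, u n = v n) -> tends u x -> tends v x.
Proof. by move=> uv ux e /ux[N hN]; exists N => n /hN; rewrite uv. Qed.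

Lemma tends_cst x : tends (fun=> x) x.
Proof. by move=> e e0; exists 0%N => n _; rewrite subrr nrm0. Qed.

Lemma tends_shift (u : nat -> H) x : tends u x -> tends (fun n => u n.+1) x.
Proof. by move=> ux e /ux[N hN]; exists N => n Nn; apply: hN; exact: leqW. Qed.

Lemma tends_le (u : nat -> H) x (c : R) :
  (forall n, nrm (u n) <= c) -> tends u x -> nrm x <= c.
Proof.
move=> uc ux; apply/ler_addgt0Pr => e /ux[N /(_ N (leqnn _)) h].
by have := uc N; have := nrmB (u N) (u N - x); rewrite opprB addrC subrK; lra.
Qed.

(** Continuity of the inner product: the adjointness relation survives limits. *)
Lemma tends_hdot0 (u v : nat -> H) x y z : (forall n, hdot (u n) y = hdot z (v n)) ->
  tends u x -> forall w, tends v w -> hdot x y = hdot z w.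
Proof.
move=> uv ux w vw; apply/eqP; rewrite -subr_eq0; apply/eqP/nrm_eq0/eqP.
rewrite eq_le nrm_ge0 andbT; apply/ler_addgt0Pl => e e0; rewrite addr0.
have y0 := nrm_ge0 y; have z0 := nrm_ge0 z.
set d := e / (4 * (nrm y + nrm z + 1)).
have d0 : 0 < d by rewrite divr_gt0// mulr_gt0//; lra.
have de : d * (4 * (nrm y + nrm z + 1)) = e.
  by rewrite /d divfK// gt_eqF// mulr_gt0//; lra.
have [N hN] := ux _ d0; have [N' hN'] := vw _ d0.
have a := hN _ (leq_maxl N N'); have b := hN' _ (leq_maxr N N').
set n := maxn N N' in a b.
have -> : hdot x y - hdot z w = hdot z (v n - w) - hdot (u n - x) y.
  by rewrite hdotBr hdotBl uv opprB [RHS]addrC subrKA.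
have := nrmB (hdot z (v n - w)) (hdot (u n - x) y).
have := weak_cauchy_schwarz z (v n - w); have := weak_cauchy_schwarz (u n - x) y.
have := nrm_ge0 (u n - x); have := nrm_ge0 (v n - w).
nra.
Qed.

(** Continuity of the inner product makes the limits adjoint to each other, so the limit
    is adjointable without any uniform estimate. *)
Lemma strong_limit (T : nat -> 'L(H)) :
  (forall x, exists l, tends (fun n => T n x) l) ->
  (forall x, exists l, tends (fun n => adj (T n) x) l) ->
  exists S, forall x, tends (fun n => T n x) (S x) /\
                      tends (fun n => adj (T n) x) (adj S x).
Proof.
move=> /choice[f hf] /choice[g hg].
have fg x y : hdot (f x) y = hdot x (g y).
  by apply: tends_hdot0 (hf x) _ (hg y) => n; rewrite adjP.
by exists (AdjOp fg) => x; split; [exact: hf | exact: hg].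
Qed.

Lemma monotone_cauchy (c : nat -> R) C : (forall n, c n <= c n.+1) ->
  (forall n, c n <= C) ->
  forall e, 0 < e -> exists N, forall n, (N <= n)%N -> c n - c N < e.
Proof.
move=> cS cC e e0.
have hs : has_sup (range c).
  by split; [exists (c 0%N); exists 0%N | exists C => _ [n _ <-]].
have [_ [N _ <-] hN] := sup_adherent e0 hs.
exists N => n Nn; have : c n <= sup (range c) by apply: ub_le_sup (hs.2) _ _; exists n.
lra.
Qed.

(** Telescoping: increments dominated by those of a bounded increasing numerical
    sequence are summable. *)
Lemma op_limit (T : nat -> 'L(H)) (c : nat -> R) C :
  (forall n, adj (T n) = T n) -> (forall n, c n <= C) ->
  (forall n, bnd (c n.+1 - c n) (T n.+1 - T n)) ->
  exists S, adj S = S /\ forall x, tends (fun n => T n x) (S x).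
Proof.
move=> Tsa cC hT.
have cS n : c n <= c n.+1 by have [] := hT n; rewrite subr_ge0.
have dist m n x : nrm (T (m + n)%N x - T m x) <= (c (m + n)%N - c m) * nrm x.
  elim: n => [|n IH]; first by rewrite addn0 !subrr nrm0 mul0r.
  have [_ /(_ x) h] := hT (m + n)%N; rewrite addnS.
  have := nrmD ((T (m + n).+1 - T (m + n)%N) x) (T (m + n)%N x - T m x).
  by rewrite opE addrA subrK; rewrite opE in h; lra.
have lim x : exists l, tends (fun n => T n x) l.
  apply: cauchy_tends => e e0.
  have x1 : 0 < 4 * (nrm x + 1) by have := nrm_ge0 x; lra.
  have [|N hN] := monotone_cauchy cS cC (e := e / (4 * (nrm x + 1))).
    by rewrite divr_gt0.
  exists N => m n Nm Nn.
  have near k : (N <= k)%N -> nrm (T k x - T N x) <= e / 4.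
    move=> /[dup] /hN h /subnKC Nk; have := dist N (k - N)%N x; rewrite Nk.
    move: h; rewrite ltr_pdivlMr// => h /le_trans; apply.
    by have := nrm_ge0 x; nra.
  have := nrmB (T m x - T N x) (T n x - T N x); rewrite opprB addrA subrK.
  by have := near _ Nm; have := near _ Nn; lra.
have [|S hS] := strong_limit lim; first by move=> x; have [l] := lim x; exists l; under eq_fun do rewrite Tsa.
exists S; split=> [|x]; last by have [] := hS x.
apply: adjopP => x; have [h1 h2] := hS x; apply: tends_uniq h2 _.
by apply: tends_ext h1 => n; rewrite Tsa.
Qed.

Lemma bnd_limit (T : nat -> 'L(H)) S c : (forall n, bnd c (T n)) ->
  (forall x, tends (fun n => T n x) (S x)) -> bnd c S.
Proof.
move=> hT TS; split=> [|x]; first by have [] := hT 0%N.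
by apply: tends_le (TS x) => n; have [_] := hT n; exact.
Qed.

(** Neumann series, for the fixed point [G = 1 + K G]. *)
Lemma neumann K q : adj K = K -> q < 1 -> bnd q K ->
  exists G, [/\ adj G = G, G * (1 - K) = 1, (1 - K) * G = 1
    & forall V, GRing.comm V K -> GRing.comm V G].
Proof.
move=> Ksa q1 hK; have [q0 _] := hK.
pose T := fix T n : 'L(H) := if n is m.+1 then 1 + K * T m else 0.
have TE n : T n.+1 = 1 + K * T n by [].
have Tcomm V n : GRing.comm V K -> GRing.comm V (T n).
  move=> VK; elim: n => [|n IH] /=; first exact: commr0.
  by apply: commrD; [exact: commr1 | exact: commrM].
have Tsa n : adj (T n) = T n.
  elim: n => [|n IH] /=; first exact: adj0.
  by rewrite adjD adj1 adjM IH Ksa; congr (_ + _); apply/esym/Tcomm.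
have TS n : T n.+1 - T n = K ^+ n.
  elim: n => [|n IH]; first by rewrite /= mulr0 addr0 subr0 expr0.
  by rewrite exprS -IH !TE; ncring.
have q1' : 0 < 1 - q by lra.
have [|n|G [Gsa hG]] := @op_limit T (fun n => (1 - q ^+ n) / (1 - q)) (1 - q)^-1 Tsa.
- by move=> n; rewrite ler_pdivrMr// mulVf ?gt_eqF// gerBl exprn_ge0.
- have -> : (1 - q ^+ n.+1) / (1 - q) - (1 - q ^+ n) / (1 - q) = q ^+ n.
    by rewrite exprS; field; rewrite gt_eqF.
  by rewrite TS; exact: bndX.
have Gfix : G = 1 + K * G.
  apply: adjopP => x; apply: (@tends_uniq _ _ (fun n => T n.+1 x)).
    exact: (tends_shift (hG x)).
  by apply: tendsD; [exact: tends_cst | exact: tends_op].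
have Gcomm V : GRing.comm V K -> GRing.comm V G.
  move=> VK; apply: adjopP => x.
  apply: (@tends_uniq _ _ (fun n => V (T n x))); first exact: tends_op.
  by apply: tends_ext (hG (V x)) => n; rewrite -!opM Tcomm.
exists G; split => //.
- have KG : K * G = G * K by apply: Gcomm.
  by rewrite mulrBr mulr1 -KG {1}Gfix addrK.
- by rewrite mulrBl mul1r {1}Gfix addrK.
Qed.

End Limits.

(** * Square roots *)

Section SquareRoots.
Variables (R : realType) (A : cstarAlgType R[i]) (H : hilbertModType A).
Implicit Types (x y z : H) (S T U V X Z P Q : 'L(H)).

Lemma rscaleA (a b : R) T : a ** (b ** T) = (a * b) ** T.
Proof. by rewrite scalerA -rmorphM. Qed.

Lemma rscaleDl (a b : R) T : (a + b) ** T = a ** T + b ** T.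
Proof. by rewrite rmorphD scalerDl. Qed.

Lemma rscale1 T : (1 : R) ** T = T.
Proof. by rewrite rmorph1 scale1r. Qed.

Lemma rscale0 T : (0 : R) ** T = 0.
Proof. by rewrite rmorph0 scale0r. Qed.

Lemma commrZ (c : R[i]) V T : GRing.comm V T -> GRing.comm V (c *: T).
Proof. by move=> VT; rewrite /GRing.comm op_mulZl op_mulZr VT. Qed.

Lemma halfK T : 2^-1 ** T + 2^-1 ** T = T.
Proof. by rewrite -rscaleDl (_ : 2^-1 + 2^-1 = 1 :> R) ?rscale1//; lra. Qed.

(** [T] is a polynomial in [K] with nonnegative coefficients, and [c] is its value at
    [1]; a bound on the powers of [K] then transfers to [T] with factor [c]. *)
Inductive dominated (K : 'L(H)) : 'L(H) -> R -> Prop :=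
| dominated_pow n : dominated K (K ^+ n) 1
| dominated0 : dominated K 0 0
| dominatedD S T c d :
    dominated K S c -> dominated K T d -> dominated K (S + T) (c + d)
| dominatedZ r T c : 0 <= r -> dominated K T c -> dominated K (r ** T) (r * c).

Lemma dominatedM K S T c d :
  dominated K S c -> dominated K T d -> dominated K (S * T) (c * d).
Proof.
move=> hS hT; elim: hS => {S c} [n||S S' c c' _ IH _ IH'|r S c r0 _ IH].
- elim: hT => {T d} [m||S S' c c' _ IH _ IH'|r S c r0 _ IH].
  + by rewrite -exprD mulr1; exact: dominated_pow.
  + by rewrite !mulr0; exact: dominated0.
  + by rewrite !mulrDr; exact: dominatedD.
  + by rewrite op_mulZr mulrCA; exact: dominatedZ.
- by rewrite !mul0r; exact: dominated0.
- by rewrite !mulrDl; exact: dominatedD.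
- by rewrite op_mulZl -mulrA; exact: dominatedZ.
Qed.

Lemma dominated_bnd K M T c :
  (forall n, bnd M (K ^+ n)) -> dominated K T c -> bnd (c * M) T.
Proof.
move=> hK; elim=> {T c} [n||S S' c c' _ IH _ IH'|r S c r0 _ IH].
- by rewrite mul1r.
- by rewrite mul0r; exact: bnd0.
- by rewrite mulrDl; exact: bndD.
- by rewrite -mulrA; exact: bndZ.
Qed.

Lemma dominated_comm K V T c : GRing.comm V K -> dominated K T c -> GRing.comm V T.
Proof.
move=> VK; elim=> {T c} [n||S S' c c' _ IH _ IH'|r S c r0 _ IH].
- exact: commrX.
- exact: commr0.
- exact: commrD.
- exact: commrZ.
Qed.

Lemma dominated_adj K T c : adj K = K -> dominated K T c -> adj T = T.
Proof.
move=> Ksa; elim=> {T c} [n||S S' c c' _ IH _ IH'|r S c r0 _ IH].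
- by rewrite adjX Ksa.
- exact: adj0.
- by rewrite adjD IH IH'.
- by rewrite adjZr IH.
Qed.

(** The iterates of [Y |-> (K + Y^2) / 2] from [0] are dominated by [K], and so are
    their increments [(Y_{n+1} - Y_n) (Y_{n+1} + Y_n) / 2].  The numerical sequence
    [c_{n+1} = (1 + c_n^2) / 2] of their coefficient sums stays below [1], so the
    operators converge; the limit satisfies [2 Y = K + Y^2]. *)
Lemma sqrt_one_sub K M : adj K = K -> (forall n, bnd M (K ^+ n)) ->
  exists Y, [/\ adj Y = Y, bnd M Y, (1 - Y) * (1 - Y) = 1 - K
    & forall V, GRing.comm V K -> GRing.comm V Y].
Proof.
move=> Ksa hK.
pose Y := fix Y n : 'L(H) := if n is m.+1 then 2^-1 ** (K + Y m * Y m) else 0.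
pose c := fix c n : R := if n is m.+1 then 2^-1 * (1 + c m * c m) else 0.
have YE n : Y n.+1 = 2^-1 ** (K + Y n * Y n) by [].
have cE n : c n.+1 = 2^-1 * (1 + c n * c n) by [].
have M0 : 0 <= M by have [] := hK 0%N.
have h2 : 0 <= 2^-1 :> R by rewrite invr_ge0.
have domY n : dominated K (Y n) (c n).
  elim: n => [|n IH]; first exact: dominated0.
  rewrite YE cE; apply: dominatedZ => //; apply: dominatedD.
    by rewrite -[X in dominated _ X _]expr1; exact: dominated_pow.
  exact: dominatedM.
have c01 n : 0 <= c n <= 1.
  by elim: n => [|n /andP[? ?]]; rewrite ?lexx ?ler01// cE; apply/andP; split; nra.
have Ycomm V n : GRing.comm V K -> GRing.comm V (Y n).
  by move=> VK; exact: dominated_comm (domY n).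
have domYS n : dominated K (Y n.+1 - Y n) (c n.+1 - c n).
  elim: n => [|n IH].
    rewrite YE cE /= !mulr0 !addr0 !subr0; apply: dominatedZ => //.
    by rewrite -[X in dominated _ X _]expr1; exact: dominated_pow.
  have -> : c n.+2 - c n.+1 = 2^-1 * ((c n.+1 - c n) * (c n.+1 + c n)).
    by rewrite (cE n.+1) (cE n); ring.
  have -> : Y n.+2 - Y n.+1 = 2^-1 ** ((Y n.+1 - Y n) * (Y n.+1 + Y n)).
    rewrite (YE n.+1) {3}(YE n) -scalerBr; congr (_ *: _).
    have e : Y n * Y n.+1 = Y n.+1 * Y n by apply: (Ycomm); apply/commr_sym/Ycomm.
    rewrite [RHS](_ : _ = K + Y n.+1 * Y n.+1 - (K + Y n * Y n)
       + (Y n.+1 * Y n - Y n * Y n.+1)); last by ncring.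
    by rewrite e subrr addr0.
  by apply: dominatedZ => //; apply: dominatedM => //; exact: dominatedD.
have Ysa n : adj (Y n) = Y n by exact: dominated_adj (domY n).
have bY n : bnd M (Y n).
  apply: bndW (dominated_bnd hK (domY n)).
  by have /andP[? ?] := c01 n; rewrite ler_piMl.
have [|n|S [Ssa hS]] := @op_limit _ _ _ Y (fun n => c n * M) M Ysa.
- by move=> n; have /andP[? ?] := c01 n; rewrite ler_piMl.
- by rewrite -mulrBl; exact: dominated_bnd.
have bS : bnd M S := bnd_limit bY hS.
have Sfix : S = 2^-1 ** (K + S * S).
  apply: adjopP => x; apply: (tends_uniq (tends_shift (hS x))).
  suff h : tends (fun n => K x + Y n (Y n x)) (K x + S (S x)).
    exact: (tends_op (2^-1 ** (1 : 'L(H)) : 'L(H)) h).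
  apply: tendsD; first exact: tends_cst.
  move=> e e0; have M1 : 0 < M + 1 by lra.
  have e2 : 0 < e / (2 * (M + 1)) by rewrite divr_gt0// mulr_gt0.
  have eE : e / (2 * (M + 1)) * (2 * (M + 1)) = e.
    by rewrite divfK// gt_eqF// mulr_gt0.
  have [N hN] := hS x _ e2; have [N' hN'] := hS (S x) _ e2.
  exists (maxn N N') => n; rewrite geq_max => /andP[/hN a /hN' b].
  have [_ /(_ (Y n x - S x))] := bY n; rewrite op_vecB => h.
  have := nrmD (Y n (Y n x) - Y n (S x)) (Y n (S x) - S (S x)).
  rewrite addrA subrK; have := nrm_ge0 (Y n x - S x); have := nrm_ge0 (Y n (S x) - S (S x)).
  nra.
exists S; split => //.
- rewrite [LHS](_ : _ = 1 - (S + S) + S * S); last by ncring.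
  by rewrite {1 2}Sfix halfK; ncring.
- move=> V VK; apply: adjopP => x.
  apply: (@tends_uniq _ _ (fun n => V (Y n x))); first exact: tends_op.
  by apply: tends_ext (hS (V x)) => n; rewrite -!opM Ycomm.
Qed.

End SquareRoots.

(** * Positive operators *)

Section Positivity.
Variables (R : realType) (A : cstarAlgType R[i]) (H : hilbertModType A).
Implicit Types (x y z : H) (S T U V X Z P Q : 'L(H)).

Lemma adj_mul0 T : adj T * T = 0 -> T = 0.
Proof.
move=> h; apply: adjopP => x; apply: hdot_eq0.
by rewrite adjP -opM h op0 hdot0r.
Qed.

Lemma isometry_bnd U : adj U * U = 1 -> bnd 1 U.
Proof.
move=> UU; split=> // x; rewrite mul1r -ler_sqr ?nnegrE ?nrm_ge0//.
by rewrite !nrm_hdot adjP -opM UU.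
Qed.

Lemma rscaleK (r : R) T : r != 0 -> r ** (r^-1 ** T) = T.
Proof. by move=> r0; rewrite rscaleA divff// rscale1. Qed.

Lemma rscaleVK (r : R) T : r != 0 -> r^-1 ** (r ** T) = T.
Proof. by move=> r0; rewrite rscaleA mulVf// rscale1. Qed.

(** Existence form of [T' = i T], keeping the imaginary unit out of the ring
    identities. *)
Lemma imag_op T : adj T = T ->
  exists2 T' : 'L(H), adj T' = - T' & T' * T' = - (T * T) /\
    forall V, GRing.comm V T -> GRing.comm V T'.
Proof.
move=> Tsa; exists ('i%C *: T).
  rewrite adjZ Tsa -scaleNr; congr (_ *: _).
  by apply/eqP; rewrite eq_complex /= oppr0 !eqxx.
split=> [|V]; last exact: commrZ.
by rewrite op_mulZl op_mulZr scalerA -expr2 sqr_i scaleN1r.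
Qed.

(** A point [(a, s)] of the unit circle gives the unitaries [a + i s] and
    [a - i s], whose mean is [a]. *)
Lemma circle_bnd (a s : 'L(H)) : adj a = a -> adj s = s -> GRing.comm a s ->
  a * a + s * s = 1 -> bnd 1 a.
Proof.
move=> asa ssa cas e; have [b bsa [bb cb]] := imag_op ssa.
have {}cas : a * b = b * a by exact: cb.
have ss : s * s = - (b * b) by rewrite bb opprK.
have u1 : bnd 1 (a + b).
  apply: isometry_bnd; rewrite adjD asa bsa -e ss.
  rewrite [LHS](_ : _ = a * a - b * b + (a * b - b * a)); last by ncring.
  by rewrite cas subrr addr0.
have u2 : bnd 1 (a - b).
  apply: isometry_bnd; rewrite adjB asa bsa -e ss.
  rewrite [LHS](_ : _ = a * a - b * b - (a * b - b * a)); last by ncring.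
  by rewrite cas subrr subr0.
rewrite -(halfK a) -scalerDr.
have -> : a + a = (a + b) + (a - b) by ncring.
rewrite [X in bnd X _](_ : 1 = 2^-1 * (1 + 1)); last by lra.
by apply: bndZ; [lra | exact: bndD].
Qed.

(** Boundedness of the powers of [a] makes the square root of [1 - a^2] available,
    which completes [a] to a point of the circle. *)
Lemma power_bounded_circle (a : 'L(H)) M : adj a = a -> (forall n, bnd M (a ^+ n)) ->
  exists s, [/\ adj s = s, s * s = 1 - a * a,
    forall V, GRing.comm V a -> GRing.comm V s, bnd 1 a & bnd 1 (1 - a * a)].
Proof.
move=> asa ha.
have [||Y [Ysa _ YY Ycomm]] := @sqrt_one_sub _ _ _ (a * a) M.
- by rewrite adjM asa.
- by move=> n; rewrite -expr2 -exprM.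
have sa : adj (1 - Y) = 1 - Y by rewrite adjB adj1 Ysa.
have sc V : GRing.comm V a -> GRing.comm V (1 - Y).
  by move=> Va; apply: commrB; [exact: commr1 | apply/Ycomm/commrM].
exists (1 - Y); split => //.
  by apply: (circle_bnd asa sa); [exact: sc | rewrite YY addrC subrK].
rewrite -YY -[1 : R]mulr1.
have b1 : bnd 1 (1 - Y).
  by apply: (circle_bnd sa asa); [apply/commr_sym/sc | rewrite YY subrK].
exact: bndM.
Qed.

(** Norm characterization of positivity, which makes the positive operators a
    cone for trivial reasons. *)
Definition pos T := adj T = T /\ exists2 t : R, 0 < t & bnd t (t ** (1 : 'L(H)) - T).

Lemma posD S T : pos S -> pos T -> pos (S + T).
Proof.
move=> [Ssa [s s0 hs]] [Tsa [t t0 ht]]; split; first by rewrite adjD Ssa Tsa.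
exists (s + t); first exact: addr_gt0.
by rewrite rscaleDl opprD addrACA; exact: bndD.
Qed.

Lemma pos_contraction T : pos T ->
  exists2 t : R, 0 < t & bnd 1 (1 - t^-1 ** T).
Proof.
move=> [_ [t t0 h]]; exists t => //.
rewrite -{1}(rscaleVK (1 : 'L(H)) (lt0r_neq0 t0)) -scalerBr.
by rewrite -(mulVf (lt0r_neq0 t0)); apply: bndZ; rewrite // invr_ge0 ltW.
Qed.

(** After scaling [a] to a contraction, [1 - a^2] is a contraction. *)
Lemma sqr_pos (a : 'L(H)) : adj a = a -> pos (a * a).
Proof.
move=> asa; have [c [c0 hc]] := bounded_op a.
have c1 : 0 < c + 1 by lra.
have c1' := lt0r_neq0 c1.
have ba : bnd 1 ((c + 1)^-1 ** a).
  rewrite -[X in bnd X _](mulVf c1'); apply: bndZ; first by rewrite invr_ge0 ltW.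
  by apply: bndW (conj c0 hc); lra.
have [|n|s [_ _ _ _ h]] := @power_bounded_circle ((c + 1)^-1 ** a) 1.
- by rewrite adjZr asa.
- exact: bnd_pow1.
split; first by rewrite adjM asa.
exists ((c + 1) * (c + 1)); first exact: mulr_gt0.
have -> : ((c + 1) * (c + 1)) ** (1 : 'L(H)) - a * a =
    ((c + 1) * (c + 1)) ** ((1 : 'L(H)) - ((c + 1)^-1 ** a) * ((c + 1)^-1 ** a)).
  by rewrite scalerBr op_mulZl op_mulZr -!rscaleA !rscaleK.
by rewrite -{1}[(c + 1) * (c + 1)]mulr1; apply: bndZ; rewrite // mulr_ge0 ?ltW.
Qed.

Lemma pos1 : pos (1 : 'L(H)).
Proof. by rewrite -[1]mulr1; apply: sqr_pos; exact: adj1. Qed.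

Lemma pos_sqrt T : pos T -> exists r, [/\ adj r = r, pos r, r * r = T
  & forall V, GRing.comm V T -> GRing.comm V r].
Proof.
move=> Tpos; have [t t0 h] := pos_contraction Tpos; have [Tsa _] := Tpos.
have [||Y [Ysa bY YY Ycomm]] := @sqrt_one_sub _ _ _ (1 - t^-1 ** T) 1.
- by rewrite adjB adj1 adjZr Tsa.
- by move=> n; exact: bnd_pow1.
have t0' : 0 < Num.sqrt t by rewrite sqrtr_gt0.
have sa : adj (Num.sqrt t ** ((1 : 'L(H)) - Y)) = Num.sqrt t ** ((1 : 'L(H)) - Y).
  by rewrite adjZr adjB adj1 Ysa.
exists (Num.sqrt t ** ((1 : 'L(H)) - Y)); split => //.
- split => //; exists (Num.sqrt t) => //.
  rewrite -scalerBr opprB addrC subrK -{1}[Num.sqrt t]mulr1.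
  by apply: bndZ => //; exact: ltW.
- rewrite op_mulZl op_mulZr rscaleA -expr2 sqr_sqrtr ?ltW// YY opprB addrC subrK.
  by rewrite rscaleK// gt_eqF.
- move=> V VT; apply/commrZ/commrB; first exact: commr1.
  by apply/Ycomm/commrB; [exact: commr1 | exact: commrZ].
Qed.

(** [f^2 + g^2 = |f + i g|^2] for commuting self-adjoint [f] and [g]. *)
Lemma sum_sqr_eq0 (f g : 'L(H)) : adj f = f -> adj g = g -> GRing.comm f g ->
  f * f + g * g = 0 -> f = 0.
Proof.
move=> fsa gsa cfg e; have [b bsa [bb cb]] := imag_op gsa.
have {}cfg : f * b = b * f by exact: cb.
have /adj_mul0/eqP : adj (f + b) * (f + b) = 0.
  rewrite adjD fsa bsa -e -(opprK (g * g)) -bb.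
  rewrite [LHS](_ : _ = f * f - b * b + (f * b - b * f)); last by ncring.
  by rewrite cfg subrr addr0.
rewrite addr_eq0 => /eqP fb.
have ff : f = - f by rewrite -{1}fsa fb adjN bsa.
by rewrite -(halfK f) {2}ff scalerN subrr.
Qed.

(** If [1 + y^2] is a contraction, [1 - (1 + y^2)^2 = - (2 y^2 + y^4)] is a square
    [s^2]; then [s^2 + r^2 = 0] with [r] a square root of [2 y^2 + y^4]. *)
Lemma bnd_one_add_sqr (y : 'L(H)) : adj y = y -> bnd 1 (1 + y * y) -> y = 0.
Proof.
move=> ysa h.
have [||s [ssa ss sc _ _]] := @power_bounded_circle (1 + y * y) 1.
- by rewrite adjD adj1 adjM ysa.
- by move=> n; exact: bnd_pow1.
pose f := Num.sqrt 2 ** y.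
have fsa : adj f = f by rewrite adjZr ysa.
have ff : f * f = y * y + y * y.
  by rewrite op_mulZl op_mulZr rscaleA -expr2 sqr_sqrtr// rscaleDl rscale1.
have yysa : adj (y * y) = y * y by rewrite adjM ysa.
have [r [rsa _ rr rc]] := pos_sqrt (posD (sqr_pos fsa) (sqr_pos yysa)).
have f0 : f = 0.
  apply: (sum_sqr_eq0 fsa yysa).
    by apply/commr_sym/commrZ/commr_sym/commrM.
  have r0 : r = 0.
    apply: (sum_sqr_eq0 rsa ssa); last by rewrite rr ss ff; ncring.
    apply: sc; apply: commrD; first exact: commr1.
    have : GRing.comm (y * y) r.
      apply: rc; rewrite ff; have c : GRing.comm (y * y) (y * y) by [].
      by apply: commrD; [exact: commrD | exact: commrM].
    exact: commr_sym.
  by rewrite -rr r0 mulr0.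
have s2 : Num.sqrt 2 != 0 :> R by rewrite gt_eqF// sqrtr_gt0.
by rewrite -(rscaleVK y s2) -/f f0 scaler0.
Qed.

Lemma mul_pow_le (th : R) n : 0 <= th < 1 -> n%:R * th ^+ n <= (1 - th)^-1.
Proof.
move=> /andP[th0 th1]; have d0 : 0 < 1 - th by lra.
rewrite -(ler_pM2r d0) mulVf ?gt_eqF//.
have key m : 0 <= th ^+ m /\ m%:R * th ^+ m * (1 - th) <= 1 - th ^+ m.
  elim: m => [|m [IH0 IH]]; first by rewrite expr0 !mul0r subrr.
  have p0 : 0 <= th ^+ m.+1 by exact: exprn_ge0.
  split=> //; rewrite exprS -natr1.
  have p1 : th ^+ m <= 1 by apply: exprn_ile1 => //; exact: ltW.
  have h1 := ler_wpM2l th0 IH.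
  have h2 : 0 <= (1 - th) * (1 - th * th ^+ m) by apply: mulr_ge0; [lra | nra].
  by set p := th ^+ m in h1 h2 *; set k := m%:R in h1 *; lra.
by have [] := key n; lra.
Qed.

(** Used to turn polynomial growth of powers into boundedness: scaling by [th < 1]
    makes the growth of the powers geometric. *)
Lemma bnd1_of_scaled (M : 'L(H)) : (forall th, 0 <= th < 1 -> bnd 1 (th ** M)) -> bnd 1 M.
Proof.
move=> h; split=> // x; rewrite mul1r leNgt; apply/negP => lt.
set a := nrm (M x) in lt; set b := nrm x in lt.
have b0 : 0 <= b := nrm_ge0 _; have a0 : 0 < a by lra.
have [|_ /(_ x)] := h ((a + b) / (2 * a)).
  by rewrite divr_ge0 ?ltr_pdivrMr//=; lra.
rewrite opE nrmZr -/a -/b ger0_norm; last by rewrite divr_ge0//; lra.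
have -> : (a + b) / (2 * a) * a = (a + b) / 2 by field; rewrite gt_eqF.
rewrite mul1r; lra.
Qed.

(** With [N = 1 - d d^*] a contraction and [M = 1 - d^* d = 1 + y^2], the
    intertwining [M d^* = d^* N] writes [M^n] as [1 - d^* (1 + N + ... + N^(n-1)) d],
    which grows at most linearly in [n]; hence [M] is a contraction. *)
Lemma neg_adj_mul (d y : 'L(H)) : adj y = y -> adj d * d = - (y * y) ->
  bnd 1 (1 - d * adj d) -> y = 0.
Proof.
move=> ysa dd hN; set N := 1 - d * adj d in hN; set M := 1 + y * y.
apply: bnd_one_add_sqr => //; apply: bnd1_of_scaled => th th01.
have ME : M = 1 - adj d * d by rewrite dd opprK.
pose g := fix g n : 'L(H) := if n is m.+1 then g m + N ^+ m else 0.
have gE n : g n.+1 = g n + N ^+ n by [].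
have inter n : M ^+ n * adj d = adj d * N ^+ n.
  elim: n => [|n IH]; first by rewrite !expr0 mul1r mulr1.
  have MN : M * adj d = adj d * N by rewrite ME /N; ncring.
  by rewrite exprSr -mulrA MN mulrA IH -mulrA -exprSr.
have Mn n : M ^+ n = 1 - adj d * g n * d.
  elim: n => [|n IH]; first by rewrite expr0 mulr0 mul0r subr0.
  have -> : 1 - adj d * g n.+1 * d = 1 - adj d * g n * d - adj d * N ^+ n * d.
    by rewrite gE; ncring.
  by rewrite -IH -inter exprSr {2}ME; ncring.
have bg n : bnd n%:R (g n).
  elim: n => [|n IH]; first exact: bnd0.
  by rewrite gE -natr1; apply: bndD => //; exact: bnd_pow1.
have [c hc] := bounded_op d; have [c' hc'] := bounded_op (adj d).
have [c0 _] := hc; have [c0' _] := hc'.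
have th0 : 0 <= th by case/andP: th01.
have [||s [_ _ _ //]] := @power_bounded_circle (th ** M) (1 + c * c' * (1 - th)^-1).
- by rewrite adjZr adjD adj1 adjM ysa.
move=> n.
have thX : (th ** M) ^+ n = th ^+ n ** M ^+ n.
  elim: n => [|n IH]; first by rewrite !expr0 rscale1.
  by rewrite !exprS IH op_mulZl op_mulZr rscaleA.
have := bndD (@bnd1 _ _ H) (bndN (bndM (bndM hc' (bg n)) hc)).
rewrite -Mn thX => /(bndZ (exprn_ge0 n th0)); apply: bndW.
have := mul_pow_le n th01; have : 0 <= c * c' by exact: mulr_ge0.
have : th ^+ n <= 1 by apply: exprn_ile1 => //; case/andP: th01 => _ /ltW.
set u := th ^+ n; set v := _^-1; set k := c * c' => h1 k0 h2.
have -> : u * (1 + c' * n%:R * c) = u + k * (n%:R * u) by rewrite /k; ring.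
by apply: lerD => //; exact: ler_wpM2l.
Qed.

(** Kelley--Vaught theorem.  Let [s = |a|] for [a = c^* c], and let [z = s - a] be
    twice the negative part of [a].  Then [d = c z] has [d^* d = - s z^2 <= 0], while
    [d d^*] is positive because [d d^* + d^* d] is a sum of squares; this is possible
    only for [s z^2 = 0], that is [z = 0]. *)
Theorem adj_mul_pos (c : 'L(H)) : pos (adj c * c).
Proof.
set a := adj c * c; have asa : adj a = a by rewrite adjM adjK.
have [s [ssa spos ss sc]] := pos_sqrt (sqr_pos asa).
have cas : a * s = s * a by apply: sc; exact: commrM.
have [r [rsa _ rr rc]] := pos_sqrt spos.
set z := s - a.
have zsa : adj z = z by rewrite adjB ssa asa.
have csz : z * s = s * z by rewrite /z mulrBl mulrBr cas.
have crz : z * r = r * z by exact: rc.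
have az : a * z = - (s * z) by rewrite /z !mulrBr cas ss opprB.
set d := c * z; set y := r * z.
have ysa : adj y = y by rewrite adjM rsa zsa crz.
have dd : adj d * d = - (y * y).
  rewrite /d adjM zsa mulrA -[z * _ * c]mulrA -/a -mulrA az mulrN; congr (- _).
  by rewrite /y mulrA -crz -rr -!mulrA.
have y0 : y = 0.
  pose e := 'i%C *: d.
  have es : adj e = - ('i%C *: adj d).
    rewrite adjZ -scaleNr; congr (_ *: _).
    by apply/eqP; rewrite eq_complex /= oppr0 !eqxx.
  have ii (S T : 'L(H)) : ('i%C *: S) * ('i%C *: T) = - (S * T).
    by rewrite op_mulZl op_mulZr scalerA -expr2 sqr_i scaleN1r.
  have hsa : adj (d + adj d) = d + adj d by rewrite adjD adjK addrC.
  have ksa : adj (e + adj e) = e + adj e by rewrite adjD adjK addrC.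
  have ysa2 := sqr_pos ysa.
  (* [2 (d d^* + d^* d) = (d + d^* )^2 + (e + e^* )^2] with [e = i d]. *)
  have : pos (d * adj d + d * adj d).
    have -> : d * adj d + d * adj d = (d + adj d) * (d + adj d)
        + (e + adj e) * (e + adj e) + y * y + y * y.
      have -> : (e + adj e) * (e + adj e) =
          - (d * d) + d * adj d + adj d * d - adj d * adj d.
        rewrite mulrDr !mulrDl es !(mulrN, mulNr) opprK !ii !opprK; ncring.
      by rewrite -[y * y]opprK -dd; ncring.
    by do 2![apply: posD => //]; apply: posD; exact: sqr_pos.
  case/pos_contraction => t t0 ht.
  have t2 : 0 < 2 / t by rewrite divr_gt0.
  pose rho := Num.sqrt (2 / t).
  have rho0 : rho != 0 by rewrite gt_eqF// sqrtr_gt0.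
  rewrite -(rscaleVK y rho0) (@neg_adj_mul (rho ** d) (rho ** y)) ?scaler0//.
  - by rewrite adjZr ysa.
  - by rewrite adjZr !op_mulZl !op_mulZr dd !scalerN.
  - rewrite adjZr op_mulZl op_mulZr rscaleA -expr2 sqr_sqrtr ?ltW//.
    by rewrite mulrC -rscaleA (rscaleDl 1 1) rscale1.
have sz : s * z = 0 by rewrite -rr -mulrA -/y y0 mulr0.
suff z0 : z = 0 by move/eqP: z0; rewrite subr_eq0 => /eqP <-.
apply: adj_mul0; rewrite zsa {1}/z mulrBl sz az sz; ncring.
Qed.

End Positivity.

(** * Absolute values and inverses *)

Section AbsoluteValues.
Variables (R : realType) (A : cstarAlgType R[i]) (H : hilbertModType A).
Implicit Types (x y z : H) (S T U V X Z P Q : 'L(H)).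

Lemma op_positiveP T : op_positive T <-> pos T.
Proof.
split=> [[X ->]|/pos_sqrt[r [rsa _ rr _]]]; first exact: adj_mul_pos.
by exists r; rewrite rsa rr.
Qed.

Lemma op_absP T : pos (op_abs T) /\ op_abs T * op_abs T = adj T * T.
Proof.
rewrite /op_abs; case: xgetP => [S _ [/op_positiveP]//|none].
have [r [_ rpos rr _]] := pos_sqrt (adj_mul_pos T).
by case: (none r); split => //; exact/op_positiveP.
Qed.

Lemma pos_adj T : pos T -> adj T = T.
Proof. by case. Qed.

(** [1 + T] is [1 + t] times [1 - (t - T) / (1 + t)], a Neumann perturbation of the
    identity since [|t - T| <= t]. *)
Lemma pos_inv T : pos T -> exists G, [/\ adj G = G, G * (1 + T) = 1, (1 + T) * G = 1
  & forall V, GRing.comm V T -> GRing.comm V G].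
Proof.
move=> [Tsa [t t0 ht]]; have t1 : 0 < 1 + t by lra.
have t1' := lt0r_neq0 t1.
have q1 : (1 + t)^-1 * t < 1 by rewrite ltr_pdivrMl//; lra.
have [||G [Gsa G1 G2 Gc]] := @neumann _ _ _ ((1 + t)^-1 ** (t ** (1 : 'L(H)) - T)) _ _ q1.
- by rewrite adjZr adjB adjZr adj1 Tsa.
- by apply: bndZ => //; rewrite invr_ge0 ltW.
have e : 1 + T = (1 + t) ** ((1 : 'L(H)) - (1 + t)^-1 ** (t ** (1 : 'L(H)) - T)).
  by rewrite scalerBr rscaleK// rscaleDl rscale1; ncring.
exists ((1 + t)^-1 ** G); split.
- by rewrite adjZr Gsa.
- by rewrite e op_mulZl op_mulZr G1 rscaleVK.
- by rewrite e op_mulZl op_mulZr G2 rscaleK.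
- move=> V VT; apply/commrZ/Gc/commrZ/commrB => //.
  by apply: commrZ; exact: commr1.
Qed.

Lemma pos_conj T Z : pos T -> pos (adj Z * T * Z).
Proof.
move=> /pos_sqrt[r [rsa _ <- _]].
have -> : adj Z * (r * r) * Z = adj (r * Z) * (r * Z).
  by rewrite adjM rsa !mulrA.
exact: adj_mul_pos.
Qed.

Lemma pos_half T : pos (T + T) -> pos T.
Proof.
move=> /(pos_conj (Num.sqrt 2^-1 ** (1 : 'L(H)))).
rewrite adjZr adj1 op_mulZl mul1r op_mulZr mulr1 rscaleA -expr2 sqr_sqrtr ?invr_ge0//.
by rewrite scalerDr halfK.
Qed.

Lemma moore_penroseE T X : T * X * T = T -> X * T * X = X ->
  adj (T * X) = T * X -> adj (X * T) = X * T -> moore_penrose T = X.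
Proof.
move=> h1 h2 h3 h4; rewrite /moore_penrose.
case: xgetP => [Y _ [g1 g2 g3 g4]|/(_ X)]; last by case.
have YX : Y * T = X * T.
  have e : Y * T = (Y * T) * (X * T) by rewrite -mulrA [T * (X * T)]mulrA h1.
  by rewrite -g4 e adjM h4 g4 -mulrA [T * (Y * T)]mulrA g1.
have TY : T * Y = T * X.
  have e : T * Y = (T * X) * (T * Y) by rewrite mulrA h1.
  by rewrite -g3 e adjM h3 g3 mulrA g1.
by rewrite -g2 YX -mulrA TY mulrA.
Qed.

Lemma op_invE T X : X * T = 1 -> T * X = 1 -> op_inv T = X.
Proof.
move=> XT TX; rewrite /op_inv; case: xgetP => [Y _ [YT _]|/(_ X)]; last by case.
by rewrite -[Y]mulr1 -TX mulrA YT mul1r.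
Qed.

End AbsoluteValues.

(** * Closures of ranges *)

Section Closures.
Variables (R : realType) (A : cstarAlgType R[i]) (H : hilbertModType A).
Implicit Types (x y z : H) (S T U V X Z P Q : 'L(H)).

Lemma closure_sub (M N : set H) : M `<=` closure N -> closure M `<=` closure N.
Proof.
move=> MN x /closureP cx; apply/closureP => e e0; have e2 : 0 < e / 2 by lra.
have [y My xy] := cx _ e2; have [z Nz yz] := (closureP _ _).1 (MN _ My) _ e2.
by exists z => //; have := nrmD (x - y) (y - z); rewrite addrA subrK; lra.
Qed.

Lemma closure_range_mul S T : closure (range (S * T)) `<=` closure (range S).
Proof. by apply/closure_sub => _ [x _ <-]; apply: subset_closure; exists (T x). Qed.

Lemma closure_range_op S T x :
  closure (range T) x -> closure (range (S * T)) (S x).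
Proof.
move=> /closureP cx; apply/closureP => e e0.
have [c [c0 hc]] := bounded_op S; have c1 : 0 < c + 1 by lra.
have [|_ [z _ <-] xz] := cx (e / (c + 1)); first exact: divr_gt0.
exists (S (T z)); first by exists z.
rewrite -op_vecB; apply: le_lt_trans (hc _) _.
by move: xz; rewrite ltr_pdivlMr//; have := nrm_ge0 (x - T z); nra.
Qed.

Lemma closure_range_eq S T U x : S * T = U * T -> closure (range T) x -> S x = U x.
Proof.
move=> ST /closureP cx; apply/eqP; rewrite -subr_eq0; apply/eqP/nrm_eq0/eqP.
rewrite eq_le nrm_ge0 andbT; apply/ler_addgt0Pl => e e0; rewrite addr0.
have [c [c0 hc]] := bounded_op (S - U); have c1 : 0 < c + 1 by lra.
have [|_ [z _ <-] xz] := cx (e / (c + 1)); first exact: divr_gt0.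
have : S x - U x = (S - U) (x - T z).
  have z0 : (S - U) (T z) = 0 by rewrite -opM mulrBl ST subrr.
  by rewrite op_vecB z0 subr0.
move=> ->; apply: le_trans (hc _) _.
by move: xz; rewrite ltr_pdivlMr//; have := nrm_ge0 (x - T z); nra.
Qed.

Lemma range_opp T : range (- T : 'L(H)) = range T.
Proof.
by apply/seteqP; split=> _ [x _ <-]; exists (- x) => //; rewrite opE op_vecN ?opprK.
Qed.

Lemma range_double T : range (T + T : 'L(H)) = range T.
Proof.
apply/seteqP; split=> _ [x _ <-].
  by exists (x + x) => //; rewrite op_vecD.
exists (2^-1 ** x) => //.
by rewrite -[in RHS](halfK T) op_vecZ !opE scalerDr.
Qed.

Lemma range_mul_unit S T T' : T * T' = 1 -> range (S * T : 'L(H)) = range S.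
Proof.
move=> TT; apply/seteqP; split=> _ [x _ <-]; first by exists (T x).
by exists (T' x) => //; rewrite -!opM -mulrA TT mulr1.
Qed.

(** [s n] is the Cesaro mean of the powers of the contraction [1 - a / t].  Telescoping
    makes [a s_n] of order [1 / n] without any spectral theory, and [1 - s_n] is
    divisible by [a], with quotient [h n]: an approximate inverse of [a]. *)
Lemma cesaro (a : 'L(H)) : pos a -> exists s h : nat -> 'L(H), exists C,
  [/\ forall n, a * h n = 1 - s n,
      forall n, adj (h n) = h n,
      forall n V, GRing.comm V a -> GRing.comm V (h n),
      forall n, bnd 1 (s n) & forall n, bnd (C / n.+1%:R) (a * s n)].
Proof.
move=> apos; have [t t0 hN] := pos_contraction apos; have asa := pos_adj apos.
have t0' := lt0r_neq0 t0; have ti0 : 0 <= t^-1 by rewrite invr_ge0 ltW.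
set N := 1 - t^-1 ** a in hN.
pose G := fix G n : 'L(H) := if n is m.+1 then G m + N ^+ m else 0.
pose W := fix W n : 'L(H) := if n is m.+1 then W m + G m else 0.
have GE n : G n.+1 = G n + N ^+ n by [].
have WE n : W n.+1 = W n + G n by [].
have Nc V : GRing.comm V a -> GRing.comm V N.
  by move=> Va; apply: commrB; [exact: commr1 | exact: commrZ].
have Gc V n : GRing.comm V a -> GRing.comm V (G n).
  move=> Va; elim: n => [|n IH]; first exact: commr0.
  by rewrite GE; apply: commrD => //; apply/commrX/Nc.
have Wc V n : GRing.comm V a -> GRing.comm V (W n).
  move=> Va; elim: n => [|n IH]; first exact: commr0.
  by rewrite WE; apply: commrD => //; exact: Gc.
have Nsa : adj N = N by rewrite adjB adj1 adjZr asa.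
have Gsa n : adj (G n) = G n.
  by elim: n => [|n IH]; rewrite ?adj0// GE adjD IH adjX Nsa.
have Wsa n : adj (W n) = W n.
  by elim: n => [|n IH]; rewrite ?adj0// WE adjD IH Gsa.
have aE : t^-1 ** a = 1 - N by rewrite opprB addrC subrK.
have aG n : (t^-1 ** a) * G n = 1 - N ^+ n.
  elim: n => [|n IH]; first by rewrite mulr0 expr0 subrr.
  by rewrite GE mulrDr IH aE mulrBl mul1r -exprS addrA subrK.
have aW n : (t^-1 ** a) * W n = n%:R ** (1 : 'L(H)) - G n.
  elim: n => [|n IH]; first by rewrite mulr0 rscale0 subrr.
  by rewrite WE mulrDr IH aG GE -natr1 rscaleDl rscale1; ncring.
have bG n : bnd n%:R (G n).
  elim: n => [|n IH]; first exact: bnd0.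
  by rewrite GE -natr1; apply: bndD => //; exact: bnd_pow1.
have n0 n : 0 <= n.+1%:R^-1 :> R by rewrite invr_ge0.
have n0' n : n.+1%:R != 0 :> R by rewrite pnatr_eq0.
exists (fun n => n.+1%:R^-1 ** G n.+1), (fun n => (n.+1%:R^-1 * t^-1) ** W n.+1), (t * 2).
split=> [n|n|n V Va|n|n].
- by rewrite op_mulZr -rscaleA -op_mulZl aW scalerBr rscaleVK.
- by rewrite adjZr Wsa.
- by apply: commrZ; exact: Wc.
- by rewrite -[X in bnd X _](mulVf (n0' n)); exact: bndZ.
- have -> : a * (n.+1%:R^-1 ** G n.+1) = (t * n.+1%:R^-1) ** ((1 : 'L(H)) - N ^+ n.+1).
    by rewrite -aG op_mulZl op_mulZr rscaleA mulrAC divff// mul1r.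
  rewrite mulrAC; apply: bndZ; first by rewrite mulr_ge0// ltW.
  by apply: bndD; [exact: bnd1 | apply/bndN/bnd_pow1].
Qed.

Lemma div_succ_small (C e : R) : 0 <= C -> 0 < e ->
  exists N, forall n, (N <= n)%N -> C / n.+1%:R < e.
Proof.
move=> C0 e0; exists (Num.Def.archi_bound (C / e)) => n Nn.
have n0 : 0 < n.+1%:R :> R by [].
rewrite ltr_pdivrMr// mulrC -ltr_pdivrMr//.
apply: (@lt_trans _ _ (Num.Def.archi_bound (C / e))%:R).
  by rewrite archi_boundP// divr_ge0// ltW.
by rewrite ltr_nat ltnS.
Qed.

(** [|X s_n x|^2 = |<s_n x, a s_n x>|] for [a = X^* X], and [a s_n] tends to zero. *)
Lemma cesaro_tends0 X (s : nat -> 'L(H)) C x :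
  (forall n, bnd 1 (s n)) -> (forall n, bnd (C / n.+1%:R) (adj X * X * s n)) ->
  tends (fun n => X (s n x)) 0.
Proof.
move=> hs ha e e0; have x0 := nrm_ge0 x.
have C0 : 0 <= C by have [] := ha 0%N; rewrite divr1.
have K0 : 0 <= C * (4 * (nrm x * nrm x)) by rewrite !mulr_ge0.
have [N hN] := div_succ_small K0 (mulr_gt0 e0 e0).
exists N => n Nn; rewrite subr0 -ltr_sqr ?nnegrE ?nrm_ge0//; last exact: ltW.
have h : nrm (hdot (X (s n x)) (X (s n x))) <=
    4 * nrm (s n x) * nrm ((adj X * X * s n) x).
  by rewrite adjP; exact: weak_cauchy_schwarz.
rewrite nrm_hdot; apply: le_lt_trans h _.
apply: le_lt_trans (hN n Nn).
have [_ /(_ x)] := hs n; have [_ /(_ x)] := ha n; rewrite mul1r.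
have -> : C * (4 * (nrm x * nrm x)) / n.+1%:R = 4 * nrm x * (C / n.+1%:R * nrm x) by ring.
by move=> h1 h2; apply: ler_pM => //; rewrite ?mulr_ge0 ?nrm_ge0// ler_wpM2l.
Qed.

(** [X x] is the limit of [X x - X s_n x = X X^* (X h_n x)]. *)
Lemma closure_range_mul_adj X : closure (range (X * adj X)) = closure (range X).
Proof.
apply/seteqP; split; first exact: closure_range_mul.
apply: closure_sub => _ [x _ <-]; apply/closureP => e e0.
have [s [h [C [ah _ hc bs b_as]]]] := cesaro (adj_mul_pos X).
have [N hN] := cesaro_tends0 x bs b_as e0.
exists ((X * adj X) (X (h N x))); first by exists (X (h N x)).
have := hN N (leqnn _); rewrite subr0; congr (nrm _ < e).
rewrite -!opM -opB; congr (adj_fun _ x).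
rewrite -[X in X - _]mulr1 -!mulrA -mulrBr [adj X * _]mulrA ah; congr (_ * _).
by rewrite opprB addrC subrK.
Qed.

Lemma closure_range_adj_mul X : closure (range (adj X * X)) = closure (range (adj X)).
Proof. by rewrite -{2}(adjK X) closure_range_mul_adj. Qed.

End Closures.

(** * Complemented submodules and polar decompositions *)

Section Polar.
Variables (R : realType) (A : cstarAlgType R[i]) (H : hilbertModType A).
Implicit Types (x y z : H) (S T U V X Z P Q : 'L(H)).

Lemma idempotent_range T x : is_idempotent T -> closure (range T) x -> T x = x.
Proof.
by move=> TT cx; apply: (closure_range_eq (U := 1) _ cx); rewrite mul1r.
Qed.

Lemma orth_complemented_projection (M : set H) T :
  is_projection_onto M T -> orth_complemented M.
Proof.
move=> [[TT Tsa] <-] z; exists (T z), (z - T z); split; first by exists z.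
  by move=> _ [w _ <-]; rewrite adjP Tsa op_vecB -opM TT subrr hdot0r.
by rewrite addrC subrK.
Qed.

Lemma orth_compl_range T x : orth_compl (closure (range T)) x -> adj T x = 0.
Proof.
move=> h; apply: hdot_eq0; rewrite -adjP; apply: h; apply: subset_closure.
by exists (adj T x).
Qed.

(** [|T^* x|^2 = |<T T^* x, x>|]. *)
Lemma bnd_adj c T : bnd c T -> bnd (4 * c) (adj T).
Proof.
move=> [c0 h]; split=> [|x]; first exact: mulr_ge0.
have [e|] := eqVneq (nrm (adj T x)) 0.
  by rewrite e !mulr_ge0 ?nrm_ge0.
rewrite neq_lt ltNge nrm_ge0 /= => n0; rewrite -(ler_pM2l n0) -expr2 nrm_hdot.
rewrite -adjP; apply: le_trans (weak_cauchy_schwarz _ _) _.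
have := h (adj T x); have := nrm_ge0 x; nra.
Qed.

(** Uniformly bounded sequences that converge on the range of [a] converge on
    its closure, so on the whole module if they vanish on the complement. *)
Lemma tends_complemented (T : nat -> 'L(H)) (a : 'L(H)) c :
  orth_complemented (closure (range a)) -> (forall n, bnd c (T n)) ->
  (forall x, exists l, tends (fun n => T n (a x)) l) ->
  (forall n x, adj a x = 0 -> T n x = 0) ->
  forall x, exists l, tends (fun n => T n x) l.
Proof.
move=> ca hT Ta T0 z; have [u [v [/closureP cu /orth_compl_range av ->]]] := ca z.
have [c0 _] := hT 0%N.
suff [l hl] : exists l, tends (fun n => T n u) l.
  by exists l; apply: tends_ext hl => n; rewrite op_vecD (T0 n v av) addr0.
apply: cauchy_tends => e e0.
have c1 : 0 < 4 * (c + 1) by lra.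
have [|_ [x _ <-] ux] := cu (e / (4 * (c + 1))); first exact: divr_gt0.
have e4 : 0 < e / 4 by lra.
have [l hl] := Ta x; have [N hN] := hl _ e4.
have cd : c * nrm (u - a x) <= e / 4.
  by move: ux; rewrite ltr_pdivlMr//; have := nrm_ge0 (u - a x); nra.
exists N => m n /hN hm /hN hn.
have near k : nrm (T k (a x) - l) < e / 4 -> nrm (T k u - l) < e / 2.
  move=> hk; have [_ /(_ (u - a x))] := hT k; rewrite op_vecB => hk'.
  by have := nrmD (T k u - T k (a x)) (T k (a x) - l); rewrite addrA subrK; lra.
have := nrmB (T m u - l) (T n u - l); rewrite opprB addrA subrK.
by have := near _ hm; have := near _ hn; lra.
Qed.

(** The partial isometry is the strong limit of [X h_n], where [|X| h_n = 1 - s_n]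
    tends to the identity on the range of [|X|].  Complementedness of the closed
    ranges of [X^*] and [X] makes [X h_n] and its adjoint [h_n X^*] converge
    everywhere, so that the limit is adjointable. *)
Theorem polar_of_complemented X : orth_complemented (closure (range X)) ->
  orth_complemented (closure (range (adj X))) -> has_polar_decomposition X.
Proof.
move=> cX cXs; split => //.
have [apos aa] := op_absP X; set a := op_abs X in apos aa *.
have asa := pos_adj apos.
have ra : closure (range a) = closure (range (adj X)).
  by rewrite -closure_range_mul_adj asa aa closure_range_adj_mul.
have [s [h [C [ah hsa hc bs bas]]]] := cesaro apos.
have nXa x : nrm (X x) = nrm (a x).
  apply/eqP; rewrite -(eqrXn2 (n := 2)) ?nrm_ge0// !nrm_hdot !adjP -!opM asa.
  by rewrite aa.
have hac n : a * h n = h n * a by apply: hc.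
have Xa0 x : a x = 0 -> X x = 0.
  by move=> e; apply: nrm_eq0; rewrite nXa e nrm0.
have as0 x : tends (fun n => a (s n x)) 0.
  move=> e e0; have C0 : 0 <= C by have [] := bas 0%N; rewrite divr1.
  have [N hN] := div_succ_small (mulr_ge0 C0 (nrm_ge0 x)) e0.
  exists N => n /hN; rewrite subr0; apply: le_lt_trans.
  by rewrite mulrAC; have [_ /(_ x)] := bas n.
have Xs0 x : tends (fun n => X (s n x)) 0.
  move=> e e0; have [N hN] := as0 x e e0.
  by exists N => n /hN; rewrite !subr0 nXa.
have hXX n : h n * adj X * X = a * (1 - s n).
  by rewrite -mulrA -aa mulrA -hac -mulrA -hac ah.
have hXXE n x : (h n * adj X) (X x) = a x - a (s n x).
  by rewrite -[LHS]/((h n * adj X * X) x) hXX opM opE op_vecB.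
have XhaE n x : (X * h n) (a x) = X x - X (s n x).
  by rewrite -opM -mulrA -hac ah opM opE op_vecB.
have bT n : bnd 2 (X * h n).
  have [_ b2] : bnd (1 + 1) (1 - s n) by apply: bndD; [exact: bnd1 | exact: bndN].
  by split=> // x; rewrite opM nXa -opM ah; exact: b2.
have cvB (u : nat -> H) x : tends u 0 -> tends (fun n => x - u n) x.
  move=> u0 e /u0[N hN]; exists N => n /hN.
  by rewrite subr0 addrAC subrr add0r nrmN.
have [||U hU] := @strong_limit _ _ _ (fun n => X * h n).
- apply: (@tends_complemented _ a 2) => //; first by rewrite ra.
    by move=> x; exists (X x); apply: tends_ext (cvB _ _ (Xs0 x)) => n; rewrite XhaE.
  move=> n x; rewrite asa => ax; apply: Xa0.
  by rewrite -opM hac opM ax op_vec0.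
- apply: (@tends_complemented _ X (4 * 2)) => //.
  + by move=> n; exact: bnd_adj.
  + move=> x; exists (a x); apply: tends_ext (cvB _ _ (as0 x)) => n.
    by rewrite adjM hsa hXXE.
  + by move=> n x e; rewrite adjM opM e op_vec0.
have Ua : U * a = X.
  apply: adjopP => x; apply: (tends_uniq (hU (a x)).1).
  by apply: tends_ext (cvB _ _ (Xs0 x)) => n; rewrite XhaE.
have UX : adj U * X = a.
  apply: adjopP => x; apply: (tends_uniq (hU (X x)).2).
  apply: tends_ext (cvB _ _ (as0 x)) => n.
  by rewrite adjM hsa hXXE.
have U0 x : a x = 0 -> U x = 0.
  move=> ax; apply: (tends_uniq (hU x).1).
  apply: tends_ext (tends_cst 0) => n; apply/esym/Xa0.
  by rewrite -opM hac opM ax op_vec0.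
set p := adj U * U.
have pa : p * a = 1 * a by rewrite -mulrA Ua UX mul1r.
have pM x : closure (range a) x -> p x = x by move=> /(closure_range_eq pa).
have psplit z : closure (range a) (p z) /\ p (p z) = p z.
  have [u [v [cu /orth_compl_range av ->]]] : exists u v,
      [/\ closure (range a) u, orth_compl (closure (range a)) v & z = u + v].
    by have := cXs z; rewrite -ra.
  have pv : p v = 0 by rewrite /p opM U0 ?op_vec0// -av asa.
  by rewrite op_vecD pv addr0 !pM.
have pp : is_projection p.
  split; first by apply: adjopP => z; have [] := psplit z.
  by rewrite adjM adjK.
exists U; split => //.
split=> //; rewrite -ra; apply/seteqP; split=> [_ [z _ <-]|x cx].
  by have [] := psplit z.
by exists x => //; exact: pM.
Qed.

Lemma polar_abs_range X :
  closure (range (op_abs X)) = closure (range (adj X)).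
Proof.
have [/pos_adj asa aa] := op_absP X.
by rewrite -closure_range_mul_adj asa aa closure_range_adj_mul.
Qed.

Lemma partial_isometryE U : partial_isometry U -> U * adj U * U = U.
Proof.
move=> [pp _]; apply/eqP; rewrite eq_sym -subr_eq0; apply/eqP/adj_mul0.
rewrite adjB !adjM adjK.
rewrite [LHS](_ : _ = adj U * U - (adj U * U) * (adj U * U)
   - ((adj U * U) * (adj U * U) - (adj U * U) * (adj U * U) * (adj U * U))).
  by rewrite pp pp !subrr.
by ncring.
Qed.

(** [U U^*] projects onto the range of [U], the image under [U] of the closed range of
    [|X|]. *)
Lemma polar_range_projection X U : partial_isometry U -> X = U * op_abs X ->
  is_projection_onto (closure (range (adj X))) (adj U * U) ->
  is_projection_onto (closure (range X)) (U * adj U).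
Proof.
move=> Upi XU [_ rU]; have UUU := partial_isometryE Upi.
have qq : is_idempotent (U * adj U) by rewrite /is_idempotent mulrA UUU.
split; first by split=> //; rewrite adjM adjK.
apply/seteqP; split=> [_ [z _ <-]|x].
  have : closure (range (op_abs X)) ((adj U * U) (adj U z)).
    by rewrite polar_abs_range -rU; exists (adj U z).
  by move=> /(@closure_range_op _ _ _ U); rewrite -XU -opM mulrA UUU.
rewrite XU => cx; exists x => //; apply: idempotent_range => //.
by apply: closure_sub cx => _ [y _ <-]; apply: subset_closure;
  exists (U (op_abs X y)) => //; rewrite -[LHS]/((U * adj U * U) (op_abs X y)) UUU.
Qed.

Lemma polar_complemented X :
  has_polar_decomposition X -> orth_complemented (closure (range X)).
Proof.
move=> [_ [U [Upi XU rU]]].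
exact: orth_complemented_projection (polar_range_projection Upi XU rU).
Qed.

End Polar.

(** * Corners of an idempotent *)

Section Corners.
Variables (R : realType) (A : cstarAlgType R[i]) (H : hilbertModType A).
Implicit Types (x y z : H) (S T U V X Z P Q : 'L(H)).

(** Both [C C^* = (E - 1) (E + 1)] and [(E - 1 + C) (E - 1 + C)^* = 2 (E - 1) E] have
    the range of [E - 1]. *)
Lemma corner_closure_range (E E1 E2 C : 'L(H)) :
  adj E = E -> E * E1 = 1 -> (E + 1) * E2 = 1 ->
  C * adj C = E * E - 1 -> C * (E - 1) = 0 ->
  closure (range (E - 1 + C)) = closure (range C).
Proof.
move=> Esa EE1 EE2 CC CE.
have EC : (E - 1) * adj C = 0.
  by rewrite -[E - 1]adjK adjB adj1 Esa -adjM CE adj0.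
have rC : closure (range (E - 1)) = closure (range C).
  rewrite -(closure_range_mul_adj C) CC.
  have -> : E * E - 1 = (E - 1) * (E + 1) by ncring.
  by rewrite (range_mul_unit _ EE2).
rewrite -rC -(closure_range_mul_adj (E - 1 + C)).
have -> : (E - 1 + C) * adj (E - 1 + C) = (E - 1) * E + (E - 1) * E.
  rewrite adjD adjB adj1 Esa.
  rewrite [LHS](_ : _ = (E - 1) * (E - 1) + C * adj C
      + (E - 1) * adj C + C * (E - 1)); last by ncring.
  by rewrite EC CE CC; ncring.
by rewrite range_double (range_mul_unit _ EE1).
Qed.

(** Let [C = U |C|] and [m = U |C| U^*], the absolute value of [C^*].  From
    [E - 1 = (E + 1)^-1 m^2] and [C^* = U^* m], the adjoint of [E - 1 + C] is [Y m] with
    [Y = (E + 1)^-1 m + U^*].  With [e = U U^*], the projection onto the closed range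
    of [m], one has [Y^* Y = (1 + V^* V) e] for [V = (E + 1)^-1 m]: so [Y] has a closed
    range, onto which [Y (1 + V^* V)^-1 Y^*] projects. *)
Lemma corner_adj_complemented (E E2 C : 'L(H)) :
  adj E = E -> (E + 1) * E2 = 1 -> E2 * (E + 1) = 1 ->
  C * adj C = E * E - 1 -> C * (E - 1) = 0 ->
  orth_complemented (closure (range C)) ->
  orth_complemented (closure (range (adj C))) ->
  orth_complemented (closure (range (adj (E - 1 + C)))).
Proof.
move=> Esa EE2 E2E CC CE cC cCs.
have [_ [U [Upi CU pU]]] := polar_of_complemented cC cCs.
have qU := polar_range_projection Upi CU pU.
have [/pos_adj asa aa] := op_absP C.
have UUU := partial_isometryE Upi.
set a := op_abs C in CU asa aa.
have Esub : adj (E - 1) = E - 1 by rewrite adjB adj1 Esa.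
have E2sa : adj E2 = E2.
  have h : adj E2 * (E + 1) = 1 by rewrite -{1}Esa -[X in _ + X]adj1 -adjD -adjM EE2 adj1.
  by rewrite -[LHS]mulr1 -EE2 mulrA h mul1r.
have pa : adj U * U * a = a.
  apply: adjopP => x; have [[pp _] rp] := pU.
  have : closure (range (adj C)) (a x).
    by rewrite -polar_abs_range; apply: subset_closure; exists x.
  by rewrite -rp => -[y _ e]; rewrite opM -e -opM pp.
have aU : a * (adj U * U) = a by have := congr1 adj pa; rewrite !adjM adjK asa.
have [m mC] : exists m, m = C * adj U by exists (C * adj U).
have mE : m = U * a * adj U by rewrite mC {1}CU.
have msa : adj m = m by rewrite mE !adjM adjK asa mulrA.
have CCE : C * adj C = U * a * a * adj U by rewrite CU adjM asa; ncring.
have mm : m * m = C * adj C.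
  rewrite CCE mE [LHS](_ : _ = U * (a * (adj U * U)) * a * adj U); last by ncring.
  by rewrite aU.
have Um : adj U * m = adj C by rewrite mE CU adjM asa !mulrA pa.
have ECs : (E - 1) * adj C = 0 by rewrite -Esub -adjM CE adj0.
(* [U] vanishes on the range of [E - 1], which is orthogonal to that of [C*]. *)
have UE : U * (E - 1) = 0.
  have ep : (E - 1) * (adj U * U) = 0.
    apply: adjopP => x; have [_ rp] := pU.
    have : closure (range (adj C)) ((adj U * U) x) by rewrite -rp; exists x.
    by apply: (closure_range_eq (U := 0)); rewrite ECs mul0r.
  have pE : adj U * U * (E - 1) = 0.
    by have := congr1 adj ep; rewrite !adjM adjK Esub adj0.
  by rewrite -UUU -!mulrA [adj U * (U * _)]mulrA pE mulr0.
have CCf : C * adj C = (E - 1) * (E + 1) by rewrite CC; ncring.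
have mul_adj0 Z : Z * (C * adj C) = 0 -> Z * C = 0.
  move=> h; rewrite -[LHS]adjK; have -> : adj (Z * C) = 0; last by rewrite adj0.
  by apply: adj_mul0; rewrite adjK adjM -!mulrA [C * _]mulrA mulrA h mul0r.
have E2c : GRing.comm E2 (E - 1).
  have -> : E - 1 = (E + 1) - (1 + 1) by ncring.
  apply: commrB; first by rewrite /GRing.comm E2E EE2.
  by apply: commrD; exact: commr1.
have UE2m : U * E2 * m = 0.
  rewrite mC mulrA mul_adj0 ?mul0r// CCf mulrA -[U * E2 * _]mulrA E2c mulrA UE.
  by rewrite !mul0r.
have mE2U : m * E2 * adj U = 0.
  by have := congr1 adj UE2m; rewrite !adjM msa E2sa adj0 mulrA.
set V := E2 * m; set e := U * adj U; set Y := V + adj U.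
have WY : adj (E - 1 + C) = Y * m.
  have -> : Y * m = E2 * (m * m) + adj U * m by rewrite /Y /V; ncring.
  by rewrite Um mm CCf mulrA E2c -mulrA E2E mulr1 adjD Esub.
have em : e * m = m by rewrite /e mE !mulrA UUU.
have me : m * e = m by have := congr1 adj em; rewrite !adjM adjK msa.
have Ve : V * e = V by rewrite /V -mulrA me.
have Ye : Y * e = Y.
  rewrite mulrDl Ve; congr (_ + _); rewrite /e mulrA -[RHS]adjK.
  by have := congr1 adj UUU; rewrite !adjM adjK mulrA.
have [G [Gsa G1 G2 _]] := pos_inv (adj_mul_pos V).
have YY : adj Y * Y = (1 + adj V * V) * e.
  have Vs : adj V = m * E2 by rewrite adjM msa E2sa.
  rewrite adjD adjK Vs.
  have -> : (1 + m * E2 * V) * e = m * E2 * (V * e) + e by ncring.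
  have -> : (m * E2 + U) * Y = m * E2 * V + m * E2 * adj U + U * E2 * m + e.
    by rewrite /Y /V /e; ncring.
  by rewrite Ve mE2U UE2m !addr0.
have GY : Y * G * adj Y * Y = Y.
  by rewrite -mulrA YY -!mulrA [G * _]mulrA G1 mul1r Ye.
apply: (@orth_complemented_projection _ _ _ _ (Y * G * adj Y)).
split; first by split; [rewrite /is_idempotent !mulrA GY | rewrite !adjM adjK Gsa mulrA].
rewrite WY; apply/seteqP; split=> [_ [z _ <-]|x cx].
  have -> : (Y * G * adj Y) z = Y (e ((G * adj Y) z)) by rewrite -{1}Ye.
  apply: closure_range_op; have [_ re] := qU.
  have : closure (range C) (e ((G * adj Y) z)) by rewrite -re; exists ((G * adj Y) z).
  by rewrite -closure_range_mul_adj -mm; exact: closure_range_mul.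
exists x => //; apply: idempotent_range; first by rewrite /is_idempotent !mulrA GY.
apply: closure_sub cx => _ [y _ <-]; apply: subset_closure; exists (Y (m y)) => //.
by rewrite -[LHS]/((Y * G * adj Y * Y) (m y)) GY.
Qed.

(** [E^2 = 1 + C C^*] is invertible, hence so is [E]. *)
Lemma corner_polar (E C T : 'L(H)) : pos E ->
  C * adj C = E * E - 1 -> C * (E - 1) = 0 -> T + T = - (E - 1 + C) ->
  closure (range T) = closure (range C) /\
  (orth_complemented (closure (range C)) ->
   orth_complemented (closure (range (adj C))) -> has_polar_decomposition T).
Proof.
move=> Epos CC CE TT; have Esa := pos_adj Epos.
have [E2 [_ E2l E2r _]] := pos_inv Epos; rewrite addrC in E2l E2r.
have [G [_ _ GG Gc]] := pos_inv (adj_mul_pos (adj C)).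
rewrite adjK CC addrC subrK in GG.
have EG : E * (E * G) = 1 by rewrite mulrA.
have rT : closure (range T) = closure (range C).
  rewrite -(corner_closure_range Esa EG E2r CC CE).
  by rewrite -(range_opp (E - 1 + C)) -TT range_double.
split=> // cC cCs; apply: polar_of_complemented; first by rewrite rT.
rewrite -(range_double (adj T)) -adjD TT adjN range_opp.
exact: corner_adj_complemented E2r E2l CC CE cC cCs.
Qed.

End Corners.

(** * Matched projections *)

Section Matched.
Variables (R : realType) (A : cstarAlgType R[i]) (H : hilbertModType A).
Implicit Types (x y z : H) (S T U V X Z P Q : 'L(H)).

(** Existence of all the operators entering the matched projection, with the
    relations that the computations below use; [b c] is the projection onto the
    range of [Q]. *)
Lemma abs_adj_idempotent Q : is_idempotent Q -> exists b c d : 'L(H),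
  [/\ [/\ op_abs (adj Q) = b, moore_penrose b = c & op_inv (b + 1) = d],
      [/\ pos b, adj c = c, adj d = d & b * b = Q * adj Q],
      [/\ Q * b = b, b * c * b = b, c * b * c = c & b * c * Q = Q],
      GRing.comm c b /\ GRing.comm d b
    & GRing.comm d c /\ (b + 1) * d = 1].
Proof.
move=> QQ; have [bpos bb] := op_absP (adj Q); have bsa := pos_adj bpos.
set b := op_abs (adj Q) in bpos bb bsa; rewrite adjK in bb.
set Qs := adj Q in bb.
have QsQs : Qs * Qs = Qs by rewrite -adjM QQ.
have bQs : b * Qs = b.
  apply/eqP; rewrite eq_sym -subr_eq0 -{1}[b]mulr1 -mulrBr; apply/eqP/adj_mul0.
  rewrite adjM bsa adjB adj1 adjK mulrA -[_ * b * b]mulrA bb.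
  rewrite [LHS](_ : _ = Q * Qs - Q * Q * Qs - (Q * (Qs * Qs) - Q * Q * (Qs * Qs))).
    by rewrite QsQs QQ !subrr.
  by ncring.
have Qb : Q * b = b by have := congr1 adj bQs; rewrite adjM bsa adjK.
set W := adj (Q - Qs) * (Q - Qs).
have WE : W = Qs * Q - Qs - Q + Q * Qs.
  rewrite /W adjB adjK -/Qs.
  rewrite [LHS](_ : _ = Qs * Q - Qs * Qs - Q * Q + Q * Qs); last by ncring.
  by rewrite QsQs QQ.
(* [1 + W = (Q + Q^* - 1)^2] commutes with [Q] and [b], and [Q (1 + W) = Q Q^* Q]; so
   [b^2 N] is the projection onto the range of [Q], and [b N] inverts [b] there. *)
have [N [Nsa N1 N2 Nc]] := pos_inv (adj_mul_pos (Q - Qs)); rewrite -/W in N1 N2 Nc.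
have QW : Q * (1 + W) = Q * Qs * Q.
  rewrite WE [LHS](_ : _ = Q * Qs * Q + (Q - Q * Q) + (Q * Q * Qs - Q * Qs)); last by ncring.
  by rewrite QQ !subrr !addr0.
have WQ : (1 + W) * Q = Q * Qs * Q.
  rewrite WE [LHS](_ : _ = Q * Qs * Q + (Q - Q * Q) + (Qs * (Q * Q) - Qs * Q)); last by ncring.
  by rewrite QQ !subrr !addr0.
have bW : b * (1 + W) = b * b * b.
  rewrite WE [LHS](_ : _ = b + (b * Qs) * Q - b * Qs - b * Q + b * (Q * Qs)); last by ncring.
  by rewrite bQs -bb; ncring.
have Wb : (1 + W) * b = b * b * b.
  rewrite WE [LHS](_ : _ = b + Qs * (Q * b) - Qs * b - Q * b + (Q * Qs) * b); last by ncring.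
  by rewrite Qb -bb; ncring.
have cancel1 V : GRing.comm V (1 + W) -> GRing.comm N V.
  move=> VW; apply/commr_sym/Nc; have -> : W = (1 + W) - 1 by ncring.
  by apply: commrB => //; exact: commr1.
have NQ : GRing.comm N Q by apply: cancel1; rewrite /GRing.comm QW WQ.
have Nb : GRing.comm N b by apply: cancel1; rewrite /GRing.comm bW Wb.
have bbNQ : b * b * N * Q = Q.
  by rewrite -mulrA NQ bb mulrA -QW -mulrA N2 mulr1.
have bbNb : b * b * N * b = b by rewrite -[X in _ * X]Qb mulrA bbNQ.
have bN : b * N = N * b by rewrite Nb.
have cbc : b * N * b * (b * N) = b * N.
  rewrite bN [LHS](_ : _ = N * (b * b * N * b)); last by ncring.
  by rewrite bbNb.
have [d0 [dsa d1 d2 dc]] := pos_inv bpos.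
have bcomm : GRing.comm b b by [].
exists b, (b * N), d0; split; [split|split|split|split|split] => //.
- apply: moore_penroseE.
  + by rewrite mulrA bbNb.
  + exact: cbc.
  + by rewrite !adjM Nsa bsa bN mulrA bN.
  + by rewrite !adjM Nsa bsa mulrA.
- by apply: op_invE; rewrite addrC.
- by rewrite adjM Nsa bsa Nb.
- by rewrite mulrA.
- by rewrite mulrA bbNQ.
- by rewrite /GRing.comm -mulrA Nb.
- by apply/commr_sym/dc.
- by apply/commr_sym/dc; rewrite /GRing.comm -mulrA Nb.
- by rewrite addrC.
Qed.

(** Since [Q] and [Q^*] differ by a sign off the diagonal, the product of a corner
    with its adjoint is a product of two blocks of [Q], which [Q^2 = Q] computes.
    The roles of [Z] are [P] and [1 - P]. *)
Lemma corner_mul_adj Q Z : is_idempotent Q -> is_projection Z ->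
  Z * adj Q * (1 - Z) = - (Z * Q * (1 - Z)) ->
  adj (Z * Q * (1 - Z)) = - ((1 - Z) * Q * Z) /\
  (Z * Q * (1 - Z)) * adj (Z * Q * (1 - Z)) =
    (Z * Q * Z) * (Z * Q * Z) - Z * Q * Z.
Proof.
move=> QQ [ZZ Zsa] h.
have e : adj (Z * Q * (1 - Z)) = - ((1 - Z) * Q * Z).
  have := congr1 adj h; rewrite !(adjM, adjN, adjB, adj1) adjK Zsa => h'.
  by rewrite -[in RHS]mulrA h' opprK.
split=> //; rewrite e.
rewrite [LHS](_ : _ = - (Z * Q * (1 - (Z + Z) + Z * Z) * Q * Z)); last by ncring.
rewrite ZZ.
rewrite [RHS](_ : _ = Z * Q * (Z * Z) * Q * Z - Z * Q * Z); last by ncring.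
rewrite ZZ [LHS](_ : _ = Z * Q * Z * Q * Z - Z * (Q * Q) * Z); last by ncring.
by rewrite QQ.
Qed.

(** With [b = |Q^*|], its Moore--Penrose inverse [c] and [d = (b + 1)^-1], write
    [w = b + Q].  Then [2 Q P = w] and [w^2 = (b + 1) w], whence
    [4 P Q P = w^* c w] and [2 (2 P Q P - P) = w^* d w].  The other corner follows from
    [2 (P Q P + (1 - P) Q (1 - P)) = Q + Q^*]: it is [- (b - Q)^* c (b - Q) / 4]. *)
Lemma matched_corners (Q : 'L(H)) (P := matched_projection Q) :
  is_idempotent Q -> quasi_projection_pair P Q ->
  pos (P * Q * P + P * Q * P - P) /\ pos (- ((1 - P) * Q * (1 - P))).
Proof.
move=> QQ [[PP Psa] _ [h1 h2 h3]].
have [b [c [d [[eb ec ed] [bpos csa dsa bb] [Qb bcb cbc bcQ] [cb db] [dc bd]]]]] :=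
  abs_adj_idempotent QQ.
have bsa := pos_adj bpos.
set Qs := adj Q in bb h1 h2 h3.
have bQs : b * Qs = b by have := congr1 adj Qb; rewrite adjM bsa.
have Qscb : Qs * (c * b) = Qs.
  by have := congr1 adj bcQ; rewrite !adjM bsa csa.
have PP2 : P + P = (b + Qs) * c * d * (b + Q).
  rewrite /P /matched_projection eb ec ed -scalerDl.
  have -> : 2^-1 + 2^-1 = 1 :> R[i] by rewrite [RHS]splitr mul1r.
  by rewrite scale1r.
have w1 : b * c * (b + Q) = b + Q by rewrite mulrDr bcb bcQ.
have w2 : Q * (b + Qs) = (b + 1) * b.
  by rewrite mulrDr Qb -bb; ncring.
have w3 : (b + Q) * (b + Q) = (b + 1) * (b + Q).
  rewrite [LHS](_ : _ = b * b + b * Q + Q * b + Q * Q); last by ncring.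
  by rewrite Qb QQ; ncring.
have db1 : d * (b + 1) = 1.
  have : GRing.comm d (b + 1) by apply: commrD => //; exact: commr1.
  by move=> ->.
have QP : Q * P + Q * P = b + Q.
  rewrite -mulrDr PP2 [LHS](_ : _ = Q * (b + Qs) * c * d * (b + Q)); last by ncring.
  rewrite w2 [LHS](_ : _ = (b + 1) * (b * c) * d * (b + Q)); last by ncring.
  have -> : (b + 1) * (b * c) * d = b * c.
    have e : GRing.comm (b * c) d.
      by apply/commr_sym/commrM.
    by rewrite -mulrA e mulrA bd mul1r.
  by [].
set A0 := P * Q * P.
have A4 : A0 + A0 + (A0 + A0) = (b + Qs) * c * (b + Q).
  rewrite [LHS](_ : _ = (P + P) * (Q * P + Q * P)); last by rewrite /A0; ncring.
  rewrite QP PP2 -mulrA w3 mulrA; congr (_ * _).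
  by rewrite -[LHS]mulrA db1 mulr1.
split.
  apply: pos_half.
  have -> : A0 + A0 - P + (A0 + A0 - P) = adj (b + Q) * d * (b + Q).
    rewrite [LHS](_ : _ = A0 + A0 + (A0 + A0) - (P + P)); last by ncring.
    rewrite A4 PP2 adjD bsa -/Qs.
    have -> : (b + Qs) * c * (b + Q) = (b + Qs) * c * ((b + 1) * d) * (b + Q).
      by rewrite bd mulr1.
    rewrite [LHS](_ : _ = (b + Qs) * (c * b * d) * (b + Q)); last by ncring.
    have -> : c * b * d = d * (b * c).
      have e : GRing.comm (c * b) d by apply/commr_sym/commrM.
      by rewrite e cb.
    rewrite [LHS](_ : _ = (b + Qs) * d * (b * c * (b + Q))); last by ncring.
    by rewrite w1.
  apply: pos_conj.
  have -> : d = adj d * 1 * d + adj d * b * d.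
    rewrite dsa [RHS](_ : _ = d * (b + 1) * d); last by ncring.
    by rewrite db1 mul1r.
  by apply: posD; apply: pos_conj => //; exact: pos1.
set D := (1 - P) * Q * (1 - P).
have h2' : (1 - P) * Qs * P = - ((1 - P) * Q * P).
  by have := (corner_mul_adj QQ (conj PP Psa) h2).1; rewrite !adjM adjB adj1 Psa mulrA.
have AD : A0 + A0 + (D + D) = Q + Qs.
  rewrite [RHS](_ : _ = (P * Q * P + P * Q * (1 - P) + (1 - P) * Q * P + (1 - P) * Q * (1 - P))
    + (P * Qs * P + P * Qs * (1 - P) + (1 - P) * Qs * P + (1 - P) * Qs * (1 - P))); last by ncring.
  by rewrite h1 h2 h2' h3 /A0 /D; ncring.
do 2!apply: pos_half.
have -> : - D + - D + (- D + - D) = adj (b - Q) * (adj c * b * c) * (b - Q).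
  rewrite [LHS](_ : _ = A0 + A0 + (A0 + A0) - (A0 + A0 + (D + D)) - (A0 + A0 + (D + D))); last by ncring.
  rewrite AD A4 csa cbc adjB bsa -/Qs.
  rewrite [(b + Qs) * _ * _](_ : _ = b * c * b + b * c * Q + Qs * (c * b) + Qs * c * Q); last by ncring.
  rewrite [(b - Qs) * _ * _](_ : _ = b * c * b - b * c * Q - Qs * (c * b) + Qs * c * Q); last by ncring.
  by rewrite bcb bcQ Qscb; ncring.
by apply/pos_conj/pos_conj.
Qed.

(** Relation between [T = P (1 - Q)] or [(1 - P) Q] and the off-diagonal corners
    [B], [B'] of [Q] (equal to each other's adjoints up to sign). *)
Definition corner_controls (T B B' : 'L(H)) :=
  closure (range T) = closure (range B) /\
  (orth_complemented (closure (range B)) ->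
   orth_complemented (closure (range B')) -> has_polar_decomposition T).

(** The positivity hypotheses say that [P Q P >= P / 2] and [(1 - P) Q (1 - P) <= 0]; the
    case of [P (1 - Q)] uses [E = 2 P Q P - 2 P + 1], that of [(1 - P) Q] uses
    [E = 1 - 2 (1 - P) Q (1 - P)]. *)
Lemma quasi_pair_corners P Q : quasi_projection_pair P Q ->
  pos (P * Q * P + P * Q * P - P) -> pos (- ((1 - P) * Q * (1 - P))) ->
  corner_controls (P * (1 - Q)) (P * Q * (1 - P)) ((1 - P) * Q * P) /\
  corner_controls ((1 - P) * Q) ((1 - P) * Q * P) (P * Q * (1 - P)).
Proof.
move=> [pP QQ [h1 h2 h3]] Fpos Dpos; have [PP Psa] := pP.
have PK : 1 - (1 - P) = P by ncring.
have PPc : (1 - P) * (1 - P) = 1 - P.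
  by rewrite [LHS](_ : _ = 1 - P - P + P * P); [rewrite PP; ncring | ncring].
have pPc : is_projection (1 - P) by split; [exact: PPc | rewrite adjB adj1 Psa].
have PcP : (1 - P) * P = 0 by rewrite mulrBl mul1r PP subrr.
have PPc0 : P * (1 - P) = 0 by rewrite mulrBr mulr1 PP subrr.
have Pcpos : pos (1 - P) by rewrite -PPc -{1}(pPc.2); exact: adj_mul_pos.
have [sB BB] := corner_mul_adj QQ pP h2.
have h2' : (1 - P) * adj Q * (1 - (1 - P)) = - ((1 - P) * Q * (1 - (1 - P))).
  by rewrite PK; have := sB; rewrite !adjM pPc.2 Psa mulrA.
have [sB' BB'] := corner_mul_adj QQ pPc h2'; rewrite PK in sB' BB'.
have [B eB] : exists B, B = P * Q * (1 - P) by exists (P * Q * (1 - P)).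
have [B' eB'] : exists B', B' = (1 - P) * Q * P by exists ((1 - P) * Q * P).
have [A0 eA] : exists A0, A0 = P * Q * P by exists (P * Q * P).
have [D eD] : exists D, D = (1 - P) * Q * (1 - P) by exists ((1 - P) * Q * (1 - P)).
rewrite -eB -eB' -?eA -?eD in sB BB sB' BB' Fpos Dpos *.
split.
- have AP : A0 * P = A0 by rewrite eA -mulrA PP.
  have PA : P * A0 = A0 by rewrite eA !mulrA PP.
  have BP : B * P = 0 by rewrite eB -mulrA PcP mulr0.
  have BA : B * A0 = 0 by rewrite eA !mulrA BP !mul0r.
  (* The summand [1 - P] makes [2 A - P] invertible on the whole module. *)
  have [||||r1 r2] := @corner_polar _ _ _ (A0 + A0 - P + (1 - P)) (B + B) (P * (1 - Q)).
  + exact: posD.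
  + rewrite adjD [LHS](_ : _ = B * adj B + B * adj B + (B * adj B + B * adj B)); last by ncring.
    rewrite BB [RHS](_ : _ = A0 * A0 + A0 * A0 + A0 * A0 + A0 * A0
       + (P * P + P * P + P * P + P * P) + (A0 + A0 + A0 + A0)
       - (P + P + P + P) - (A0 * P + A0 * P + A0 * P + A0 * P)
       - (P * A0 + P * A0 + P * A0 + P * A0)); last by ncring.
    by rewrite AP PA PP; ncring.
  + rewrite [LHS](_ : _ = B * A0 + B * A0 + B * A0 + B * A0
       - (B * P + B * P + B * P + B * P)); last by ncring.
    by rewrite BA BP !addr0 subr0.
  + by rewrite eA eB; ncring.
  + split; first by rewrite r1 range_double.
    by move: r2; rewrite adjD sB range_double range_double range_opp.
- have BD : B' * D = 0 by rewrite eB' eD !mulrA -[_ * P * (1 - P)]mulrA PPc0 mulr0 !mul0r.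
  have [||||r1 r2] := @corner_polar _ _ _ (1 + - D + - D) (- (B' + B')) ((1 - P) * Q).
  + by do 2?[apply: posD => //]; exact: pos1.
  + rewrite adjN adjD [LHS](_ : _ = B' * adj B' + B' * adj B' + (B' * adj B' + B' * adj B')); last by ncring.
    by rewrite BB'; ncring.
  + rewrite [LHS](_ : _ = B' * D + B' * D + B' * D + B' * D); last by ncring.
    by rewrite BD !addr0.
  + by rewrite eD eB'; ncring.
  + split; first by rewrite r1 range_opp range_double.
    by move: r2; rewrite adjN adjD sB' !range_opp !range_double range_opp.
Qed.

End Matched.

Theorem theorem4p4 (R : realType) (A : cstarAlgType R[i]) (H : hilbertModType A)
    (Q : 'L(H)) (hQ : is_idempotent Q) :
  harmonious (matched_projection Q) Q <-> semi_harmonious (matched_projection Q) Q.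
Proof.
set P := matched_projection Q.
have key : quasi_projection_pair P Q ->
    corner_controls (P * (1 - Q)) (P * Q * (1 - P)) ((1 - P) * Q * P) /\
    corner_controls ((1 - P) * Q) ((1 - P) * Q * P) (P * Q * (1 - P)).
  by move=> qp; have [F D] := matched_corners hQ qp; exact: quasi_pair_corners.
split=> [[qp c1 c2]|[qp p1 p2]]; have [[r1 q1] [r2 q2]] := key qp.
  by split => //; [exact: q1 | exact: q2].
by split => //; [rewrite -r1 | rewrite -r2]; exact: polar_complemented.
Qed.
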